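(* Let $\rho:\mathcal R\to\mathcal R$ be the $\mathbb Q$-linear map determined by $\rho(\overleftarrow{\mathfrak S}_w)=\overleftarrow{\mathfrak S}_{\widehat w}$ for all $w\in S_{\mathbb Z}$. Then $\rho$ sends back stable SEMs to back stable CHMs, namely $\rho(\overleftarrow{\mathbf e}_\alpha)=\overleftarrow{\mathbf h}_{\widehat\alpha}$ for every $\alpha\in\mathcal C$, and it keeps coefficients unchanged: for every $w\in S_{\mathbb Z}$, if $\overleftarrow{\mathfrak S}_w=\sum_{\alpha\in\mathcal C}\overleftarrow{\kappa^w_\alpha}\,\overleftarrow{\mathbf e}_\alpha$ is the back stable SEM expansion, then $$\overleftarrow{\mathfrak S}_{\widehat w}=\sum_{\alpha\in\mathcal C}\overleftarrow{\kappa^w_\alpha}\,\overleftarrow{\mathbf h}_{\widehat\alpha}.$$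
   Context: Ring. $\Lambda^-=\Lambda(\ldots,x_{-1},x_0)$ is the ring of symmetric functions over $\mathbb Q$ in the variables $x_i$, $i\le 0$, and $\mathcal R=\Lambda^-\otimes_{\mathbb Q}\mathbb Q[x_i\mid i\in\mathbb Z]$, identified via multiplication with a ring of bounded-degree formal power series in the variables $x_i$, $i\in\mathbb Z$. For every $k\in\mathbb Z$ and $d\ge 0$ the elementary and complete homogeneous symmetric functions $\mathbf e_d(\ldots,x_{k-1},x_k)$, $\mathbf h_d(\ldots,x_{k-1},x_k)$ in the variables $x_i$, $i\le k$, lie in $\mathcal R$. Back stable SEMs and CHMs. $\mathcal C$ is the set of finitely supported tuples $\alpha=(\alpha_i)_{i\in\mathbb Z}$ of nonnegative integers. For $\alpha\in\mathcal C$, the back stable SEM is $\overleftarrow{\mathbf e}_\alpha=\prod_{i\in\mathbb Z}\mathbf e_{\alpha_i}(\ldots,x_{i-1},x_i)$ and the back stable CHM is $\overleftarrow{\mathbf h}_\alpha=\prod_{i\in\mathbb Z}\mathbf h_{\alpha_i}(\ldots,x_{i-1},x_i)$. The $\overleftarrow{\mathbf e}_\alpha$ form a $\mathbb Q$-basis of $\mathcal R$. Permutations. $S_{\mathbb Z}$ is the group of permutations of $\mathbb Z$ moving only finitely many integers; $S_\infty\subset S_{\mathbb Z}$ is the subgroup of those fixing every $i\le 0$; $s_i=(i,i+1)$; $\ell$ is Coxeter length. The shift $\gamma$ acts by $\gamma(w)(i)=w(i-1)+1$ and $\gamma(x_i)=x_{i+1}$. Schubert polynomials. For $w\in S_\infty$,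 $\mathfrak S_w$ is the usual Schubert polynomial: $\mathfrak S_{w_0}=x_1^{n-1}x_2^{n-2}\cdots x_{n-1}$ for the longest $w_0\in S_n$, and $\partial_i\mathfrak S_w=\mathfrak S_{ws_i}$ whenever $\ell(ws_i)<\ell(w)$, where $\partial_i f=(f-s_if)/(x_i-x_{i+1})$. For $w\in S_{\mathbb Z}$, $\overleftarrow{\mathfrak S}_w=\lim_{m\to\infty}\gamma^{-m}\big(\mathfrak S_{\gamma^m(w)}\big)$ (coefficientwise limit, over $m$ with $\gamma^m(w)\in S_\infty$). The $\overleftarrow{\mathfrak S}_w$, $w\in S_{\mathbb Z}$, form a $\mathbb Q$-basis of $\mathcal R$ (Lam–Lee–Shimozono), so $\rho$ is well defined. Dynkin reversal. For $w\in S_{\mathbb Z}$, $\widehat w$ is given by $\widehat w(i)=1-w(1-i)$ (equivalently $s_i\mapsto s_{-i}$ on simple reflections). For $\alpha\in\mathcal C$, $\widehat\alpha_i=\alpha_{-i}$. *)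

(* Defs.v *)
From HB Require Import structures.
From mathcomp Require Import all_boot all_order all_algebra finmap.
From mathcomp.multinomials Require Import monalg.
From mathcomp Require Import boolp classical_sets functions cardinality fsbigop.

Set Implicit Arguments.
Unset Strict Implicit.
Unset Printing Implicit Defensive.
Import Order.TTheory GRing.Theory Num.Theory.
Local Open Scope classical_set_scope.
Local Open Scope ring_scope.

(** * Formal power series over [rat] in the variables x_i, i : int *)

Definition mon := {cmonom int}.

(* No degree bound is built in: [bounded_degree] below is a predicate. *)
Definition series := mon -> rat.

Lemma seriesP (f g : series) : (forall m, f m = g m) -> f = g.
Proof. exact: funext. Qed.

(* The instances below belong to the constant [series]: its product is the
   Cauchy product, not the pointwise product of the type [mon -> rat]. *)
HB.instance Definition _ := gen_eqMixin series.
HB.instance Definition _ := gen_choiceMixin series.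

Definition szero : series := fun=> 0.
Definition sopp (f : series) : series := fun m => - f m.
Definition sadd (f g : series) : series := fun m => f m + g m.

Fact saddA : associative sadd.
Proof. by move=> f g h; apply: seriesP => m; rewrite /sadd addrA. Qed.
Fact saddC : commutative sadd.
Proof. by move=> f g; apply: seriesP => m; rewrite /sadd addrC. Qed.
Fact sadd0 : left_id szero sadd.
Proof. by move=> f; apply: seriesP => m; rewrite /sadd add0r. Qed.
Fact saddN : left_inverse szero sopp sadd.
Proof. by move=> f; apply: seriesP => m; rewrite /sadd addNr. Qed.

HB.instance Definition _ := GRing.isZmodule.Build series saddA saddC sadd0 saddN.

Lemma seriesD (f g : series) m : (f + g) m = f m + g m.
Proof. by []. Qed.

Definition factorizations (m : mon) : set (mon * mon) :=
  [set p | (mmul p.1 p.2 : mon) = m].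

Definition sone : series := fun m => (m == mone)%:R.

Definition smul (f g : series) : series :=
  fun m => \sum_(p \in factorizations m) (f p.1 * g p.2).

Lemma finite_divisors (m : mon) :
  finite_set [set a : mon | exists b : mon, mmul a b = m].
Proof.
pose h (phi : {ffun finsupp m -> 'I_(mdeg m).+1}) : mon :=
  CMonom [fsfun x : finsupp m => (phi x : nat) | 0%N].
apply: (@sub_finite_set _ _ (h @` [set: {ffun finsupp m -> 'I_(mdeg m).+1}])).
  move=> a [b abm].
  have le i : (a i <= m i)%N by rewrite -abm cmM leq_addr.
  exists [ffun x : finsupp m => inord (a (val x))] => //.
  apply/eqP/cmP => i; rewrite /h /= fsfun_ffun.
  case: insubP => [x _ xi|]; last first.
    rewrite -cmE_eq0 => /eqP mi; apply/esym/eqP; rewrite -leqn0.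
    by rewrite (leq_trans (le i)) // mi.
  rewrite /= ffunE inordK xi // ltnS (leq_trans (le i)) //.
  rewrite mdegE (big_fsetD1 i) /= ?leq_addr // -xi; exact: valP.
by apply: finite_image.
Qed.

Lemma finite_factorizations (m : mon) : finite_set (factorizations m).
Proof.
pose D := [set a : mon | exists b : mon, mmul a b = m].
apply: (@sub_finite_set _ _ (D `*` D)).
  by move=> [a b] /= abm; split; [exists b | exists a; rewrite mulmC].
by apply: finite_setX; exact: finite_divisors.
Qed.

Definition divisors_mon (m : mon) : {fset mon} :=
  fset_set [set a : mon | exists b : mon, mmul a b = m].

Lemma divisors_monP (m a : mon) :
  reflect (exists b : mon, mmul a b = m) (a \in divisors_mon m).
Proof.
rewrite in_fset_set; last exact: finite_divisors.
by apply: (iffP idP); rewrite inE.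
Qed.

Lemma smulE (f g : series) (m n : mon) : n \in divisors_mon m ->
  smul f g n = \sum_(a <- divisors_mon m) \sum_(b <- divisors_mon m)
                 (if mmul a b == n then f a * g b else 0).
Proof.
move=> /divisors_monP[c ncm]; rewrite /smul.
pose D := divisors_mon m; rewrite -/D.
have inD (a b : mon) : mmul a b = n -> (a \in D) && (b \in D).
  move=> abn; apply/andP; split; apply/divisors_monP.
    by exists (mmul b c); rewrite mulmA abn.
  by exists (mmul a c); rewrite mulmA (mulmC b) abn.
pose r := [seq p <- [seq (a, b) | a <- D, b <- D] | mmul p.1 p.2 == n].
rewrite (fsbig_fwiden r) /=.
- by rewrite /r big_filter big_mkcond big_allpairs_dep.
- move=> [a b] /= abn; rewrite mem_filter /= {1}abn eqxx /=.
  by have /andP[aD bD] := inD _ _ abn; apply: allpairs_f.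
- apply: filter_uniq; apply: allpairs_uniq; rewrite ?fset_uniq //.
  by move=> [? ?] [? ?] _ _ /= [-> ->].
- by move=> p /= [+ np]; rewrite mem_filter => /andP[/eqP].
Qed.

Lemma smul_deg (f g : series) (m : mon) :
  smul f g m = \sum_(a <- divisors_mon m) \sum_(b <- divisors_mon m)
                 (if mmul a b == m then f a * g b else 0).
Proof.
by apply: smulE; apply/divisors_monP; exists mone; rewrite mulm1.
Qed.

Lemma smulC : commutative smul.
Proof.
move=> f g; apply: funext => m; rewrite !smul_deg exchange_big /=.
by apply: eq_bigr => a _; apply: eq_bigr => b _; rewrite mulmC mulrC.
Qed.

Lemma smulDl : left_distributive smul +%R.
Proof.
move=> f g h; apply: funext => m; rewrite seriesD !smul_deg -big_split /=.
apply: eq_bigr => a _; rewrite -big_split /=; apply: eq_bigr => b _.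
by case: ifP; rewrite ?addr0 // seriesD mulrDl.
Qed.

Lemma smul1 : left_id sone smul.
Proof.
move=> f; apply: funext => m; rewrite smul_deg.
have oneD : mone \in divisors_mon m.
  by apply/divisors_monP; exists m; rewrite mul1m.
have mD : m \in divisors_mon m.
  by apply/divisors_monP; exists mone; rewrite mulm1.
rewrite (bigD1_seq mone) ?fset_uniq //= (bigD1_seq m) ?fset_uniq //=.
rewrite mul1m eqxx /sone eqxx mul1r.
rewrite [X in _ + X + _]big1 => [|b /negbTE neb]; last by rewrite mul1m neb.
rewrite [X in _ + X]big1 ?addr0 // => a /negbTE nea.
by rewrite big1 // => b _; rewrite nea mul0r if_same.
Qed.

Lemma smulA : associative smul.
Proof.
have main f g h m : smul f (smul g h) m =
    \sum_(a <- divisors_mon m) \sum_(b <- divisors_mon m)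
    \sum_(c <- divisors_mon m)
      (if mmul a (mmul b c) == m then f a * (g b * h c) else 0).
  rewrite smul_deg; apply: eq_bigr => a _.
  transitivity (\sum_(d <- divisors_mon m) \sum_(b <- divisors_mon m)
    \sum_(c <- divisors_mon m) (if mmul b c == d then
      if mmul a (mmul b c) == m then f a * (g b * h c) else 0 else 0)).
    rewrite [LHS]big_seq [RHS]big_seq; apply: eq_bigr => d dD.
    case: eqVneq => [adm|ne]; last first.
      rewrite big1 // => b _; rewrite big1 // => c _.
      by case: eqVneq => // ->; rewrite (negbTE ne).
    rewrite (smulE _ _ dD) mulr_sumr; apply: eq_bigr => b _.
    rewrite mulr_sumr; apply: eq_bigr => c _.
    by case: eqVneq => [->|]; rewrite ?mulr0 // adm eqxx.
  rewrite exchange_big /=; apply: eq_bigr => b _.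
  rewrite exchange_big /=; apply: eq_bigr => c _.
  case: (eqVneq (mmul a (mmul b c)) m) => [e|_]; last first.
    by rewrite big1 // => d _; rewrite if_same.
  have bcD : mmul b c \in divisors_mon m.
    by apply/divisors_monP; exists a; rewrite mulmC.
  rewrite (bigD1_seq (mmul b c)) ?fset_uniq //= eqxx.
  by rewrite [X in _ + X]big1 ?addr0 // => d /negbTE; rewrite eq_sym => ->.
move=> f g h; apply: funext => m.
rewrite (smulC (smul f g)) !main [RHS]exchange_big /=.
apply: eq_bigr => a _; rewrite [RHS]exchange_big /=.
apply: eq_bigr => b _; apply: eq_bigr => c _.
by rewrite [h c * _]mulrC mulrA [mmul c _]mulmC mulmA.
Qed.

Fact sone_neq0 : sone != 0 :> series.
Proof.
apply/eqP => /(congr1 (fun f : series => f mone)).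
by rewrite /sone eqxx => /eqP; rewrite oner_eq0.
Qed.

HB.instance Definition _ := GRing.Zmodule_isComNzRing.Build series
  smulA smulC smul1 smulDl sone_neq0.

Definition sscale (a : rat) (f : series) : series := fun m => a * f m.

Fact sscaleA (a b : rat) (f : series) : sscale a (sscale b f) = sscale (a * b) f.
Proof. by apply: seriesP => m; rewrite /sscale mulrA. Qed.
Fact sscale1 : left_id 1 sscale.
Proof. by move=> f; apply: seriesP => m; rewrite /sscale mul1r. Qed.
Fact sscaleDr : right_distributive sscale +%R.
Proof. by move=> a f g; apply: seriesP => m; rewrite /sscale !seriesD mulrDr. Qed.
Fact sscaleDl (f : series) : {morph sscale^~ f : a b / a + b}.
Proof. by move=> a b; apply: seriesP => m; rewrite seriesD /sscale mulrDl. Qed.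

HB.instance Definition _ := GRing.Zmodule_isLmodule.Build rat series
  sscaleA sscale1 sscaleDr sscaleDl.

Fact sscaleAl (a : rat) (f g : series) : a *: (f * g) = (a *: f) * g.
Proof.
apply: seriesP => m; change (a * smul f g m = smul (sscale a f) g m).
rewrite !smul_deg mulr_sumr; apply: eq_bigr => b _.
rewrite mulr_sumr; apply: eq_bigr => c _.
by case: ifP => _; rewrite ?mulr0 // /sscale mulrA.
Qed.

HB.instance Definition _ := GRing.Lmodule_isLalgebra.Build rat series sscaleAl.
HB.instance Definition _ := GRing.Lalgebra_isComAlgebra.Build rat series.

Definition Xvar (i : int) : series := fun m => (m == ucm i)%:R.

(** The elementary and complete homogeneous symmetric functions of degree [d]
    in the variables x_i, i <= k. *)
Definition elem (d : nat) (k : int) : series := fun m =>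
  [&& mdeg m == d, all (fun i => i <= k) (finsupp m)
    & all (fun i => m i == 1%N) (finsupp m)]%:R.

Definition homog (d : nat) (k : int) : series := fun m =>
  ((mdeg m == d) && all (fun i => i <= k) (finsupp m))%:R.

(** [mren s m] is the monomial obtained from [m] by x_i |-> x_(s i).  For a
    bijection [s] of the indices, the series obtained from [f] by
    x_i |-> x_(s i) has coefficient [f (mren s^-1 m)] at [m]. *)
Definition mren (s : int -> int) (m : mon) : mon :=
  \big[@mmul mon/mone]_(i <- finsupp m) expcmn (ucm (s i)) (m i).

(** * Permutations of the integers *)

Definition SZ : set (int -> int) :=
  [set w | bijective w /\ finite_set [set i | w i <> i]].

Definition Sinf : set (int -> int) :=
  [set w | SZ w /\ forall i, i <= 0 -> w i = i].

Definition sref (i : int) : int -> int := fun j =>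
  if j == i then i + 1 else if j == i + 1 then i else j.

Definition word (t : seq int) : int -> int :=
  foldr (fun i w => sref i \o w) id t.

(** Coxeter length: the least length of a word in the simple reflections. *)
Definition coxlen (w : int -> int) : nat :=
  xget 0%N [set k | (exists t, size t = k /\ word t = w) /\
                    (forall t, word t = w -> (k <= size t)%N)].

(** The longest element of S_n. *)
Definition wlong (n : nat) : int -> int := fun i =>
  if (1 <= i) && (i <= n%:Z) then n%:Z + 1 - i else i.

(** The shift: [gammaP] on permutations, and the inverse shift
    x_i |-> x_(i-1) on series. *)
Definition gammaP (w : int -> int) : int -> int := fun i => w (i - 1) + 1.

Definition gammaV (f : series) : series :=
  fun m => f (mren (fun i => i + 1) m).

Definition hatP (w : int -> int) : int -> int := fun i => 1 - w (1 - i).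

(** * Schubert polynomials *)

Definition sact (i : int) (f : series) : series := fun m => f (mren (sref i) m).

(** The quotient of [f - s_i f] by [x_i - x_(i+1)], unique because
    [x_i - x_(i+1)] is not a zero divisor. *)
Definition ddiff (i : int) (f : series) : series :=
  xget 0 [set g : series | (Xvar i - Xvar (i + 1)) * g = f - sact i f].

Definition schubert_family (F : (int -> int) -> series) : Prop :=
  (forall n : nat,
     F (wlong n) = \prod_(1 <= i < n) Xvar i%:Z ^+ (n - i)) /\
  (forall (w : int -> int) (i : int), Sinf w ->
     (coxlen (w \o sref i) < coxlen w)%N ->
     ddiff i (F w) = F (w \o sref i)).

(** The two clauses of [schubert_family] determine the values on [Sinf]. *)
Definition schubert : (int -> int) -> series :=
  xget (fun=> 0) [set F | schubert_family F].

(** Coefficientwise limit: each coefficient is eventually constant. *)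
Definition bschubert (w : int -> int) : series := fun m =>
  xget 0 [set c : rat | exists N : nat, forall k : nat, (N <= k)%N ->
            Sinf (iter k gammaP w) ->
            iter k gammaV (schubert (iter k gammaP w)) m = c].

(** * The back stable ring *)

Definition bounded_degree (f : series) : Prop :=
  exists d : nat, forall m, f m != 0 -> (mdeg m <= d)%N.

(** Symmetric functions in the variables x_i, i <= 0. *)
Definition Lambda_minus : set series :=
  [set f | [/\ bounded_degree f,
    forall m, f m != 0 -> forall i, 0 < i -> m i = 0%N
  & forall w, SZ w -> (forall i, 0 < i -> w i = i) ->
      forall m, f (mren w m) = f m]].

Definition polynomial_series : set series :=
  [set f | finite_set [set m | f m != 0]].

(** The image of the multiplication map on the tensor product of
    [Lambda_minus] and the polynomial ring. *)
Definition back_ring : set series :=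
  [set f | exists s : seq (series * series),
    (forall p, p \in s -> Lambda_minus p.1 /\ polynomial_series p.2) /\
    f = \sum_(p <- s) p.1 * p.2].

(** * Back stable SEMs and CHMs *)

Definition cindex := {fsfun int -> nat with 0%N}.

Definition hatI (a : cindex) : cindex :=
  [fsfun i in [fset - j | j in finsupp a]%fset => a (- i) | 0%N].

(** Factors outside the support of [a] have degree 0 and equal 1. *)
Definition bsem (a : cindex) : series := \prod_(i <- finsupp a) elem (a i) i.

Definition bchm (a : cindex) : series := \prod_(i <- finsupp a) homog (a i) i.

(* Main.v *)
Require Import Defs.
From HB Require Import structures.
From mathcomp Require Import all_boot all_order all_algebra finmap.
From mathcomp.multinomials Require Import monalg.
From mathcomp Require Import boolp classical_sets functions cardinality fsbigop.
From mathcomp Require Import zify.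

Import Order.TTheory GRing.Theory Num.Theory.
Local Open Scope ring_scope.

(** [rho] is a ring homomorphism: it sends e_d(x_i, i <= k) to
    h_d(x_i, i <= -k), hence x_k to - x_(1-k), and it intertwines the divided
    differences d_i and d_(-i), because d_k e_d(k) = e_(d-1)(k-1) and
    d_k h_d(k) = h_(d-1)(k+1).  So consider the set of pairs generated as a ring
    by the (e_d(k), h_d(-k)); by the Leibniz rule it is stable under
    (d_i, d_(-i)), and its pairs have equal constant terms.  A series of the back
    stable ring killed by every d_i is symmetric in all variables, hence constant.
    By induction on the degree, a pair whose first component is a combination of
    back stable Schubert series has the reversed combination as its second
    component.  Since a SEM f is such a combination, namely the sum over w of the
    constant term of d_w f times the Schubert series of w, both claims follow. *)

(** Defining the homomorphism on the generators e_d(k) would require their algebraic independence.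
    The pairs avoid this: that the first component determines the second is shown only for first
    components written as combinations of Schubert series, which is all that is asked. The signs fit
    because x_i and x_(i+1) go to - x_(1-i) and - x_(-i), so that x_i - x_(i+1) goes to x_(-i) -
    x_(1-i), the divisor of d_(-i). Two obstacles shape the proof. Schubert polynomials and back
    stable limits are given by choice ([xget]), so their existence has to be established:
    independence of the reduced word, independence of n, stability under the shift. And a
    decomposition into tensors, as in [back_ring], is awkward to carry through divided differences;
    the argument therefore runs in a class [nice] of series and returns to [back_ring] only where
    the linearity of [rho] is invoked. *)

(** * Monomials and renaming of their variables *)

Lemma monP (m n : mon) : (forall i, m i = n i) -> m = n.
Proof. by move=> h; apply/eqP/cmP. Qed.

Lemma monM (m n : mon) i : (mmul m n : mon) i = (m i + n i)%N.
Proof. exact: cmM. Qed.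

Lemma mon1 i : (mone : mon) i = 0%N.
Proof. exact: cm1. Qed.

Lemma monU i j : (ucm i : mon) j = (i == j) :> nat.
Proof. exact: ucmE. Qed.

Lemma expcmnE (m : mon) n : expcmn m n = iter n (mulcm m) (onecm int).
Proof.
case: n => // n; elim: n => [|n IH].
  by apply: monP => j; rewrite mulcmE onecmE addn0.
by transitivity (mulcm m (expcmn m n.+1)); last by rewrite IH.
Qed.

Lemma monX (m : mon) n i : (expcmn m n) i = (n * m i)%N.
Proof.
rewrite expcmnE; elim: n => [|n IH] /=; first by rewrite onecmE mul0n.
by rewrite mulcmE IH mulSn.
Qed.

Lemma mon_neq1 (m : mon) : m != mone -> exists i, m i != 0%N.
Proof.
move=> m1; apply: contrapT => h; case/eqP: m1; apply: monP => i.
by rewrite mon1; apply/eqP/negPn/negP => mi; apply: h; exists i.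
Qed.

Lemma mon_big (I : Type) (r : seq I) (F : I -> mon) j :
  (\big[@mmul mon/mone]_(i <- r) F i : mon) j = (\sum_(i <- r) F i j)%N.
Proof.
elim: r => [|x r IH]; first by rewrite !big_nil mon1.
by rewrite !big_cons monM IH.
Qed.

Lemma mren_sum (s : int -> int) (m : mon) j :
  mren s m j = (\sum_(i <- finsupp m) m i * (s i == j))%N.
Proof.
by rewrite /mren mon_big; apply: eq_bigr => i _; rewrite monX monU.
Qed.

Lemma mrenE (s : int -> int) (m : mon) i : injective s -> mren s m (s i) = m i.
Proof.
move=> sI; rewrite mren_sum; have [im|] := boolP (i \in finsupp m).
  rewrite (big_fsetD1 i) //= eqxx muln1 big_seq big1 ?addn0 // => k.
  by rewrite !inE (inj_eq sI) => /andP[/negbTE -> _]; rewrite muln0.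
move=> im; move: (im); rewrite -cmE_eq0 => /eqP ->.
rewrite big_seq big1 // => k kin; rewrite (inj_eq sI).
by case: eqP => [e|]; rewrite ?muln0 //; rewrite -e kin in im.
Qed.

Lemma mren_out (s : int -> int) (m : mon) j :
  (forall i, s i <> j) -> mren s m j = 0%N.
Proof.
by move=> h; rewrite mren_sum big1 // => i _; case: eqP => [/h|]; rewrite ?muln0.
Qed.

Lemma mrenK (s t : int -> int) (m : mon) j : cancel s t -> cancel t s ->
  mren s m j = m (t j).
Proof. by move=> st ts; rewrite -{1}[j]ts mrenE //; apply: can_inj st. Qed.

(** Injectivity suffices: outside the images both exponents are 0. The renaming [squash] used later
    is not surjective. *)
Lemma mren_comp (s t : int -> int) (m : mon) : injective s -> injective t ->
  mren s (mren t m) = mren (s \o t) m.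
Proof.
move=> sI tI; apply: monP => j.
have [[i <-]|n] := pselect (exists i, s i = j); last first.
  by rewrite !mren_out // => i h; apply: n; [exists (t i)|exists i].
rewrite mrenE //; have [[k <-]|n] := pselect (exists k, t k = i).
  by rewrite mrenE // (mrenE (s \o t)) //; apply: inj_comp.
rewrite !mren_out // => k /= h; apply: n; exists k => //.
exact: sI.
Qed.

Lemma mren_id (m : mon) : mren id m = m.
Proof. by apply: monP => j; rewrite (mrenK id id). Qed.

Lemma mdeg_mren (s : int -> int) (m : mon) : mdeg (mren s m) = mdeg m.
Proof.
rewrite /mren mdeg_prod mdegE; apply: eq_bigr => i _.
rewrite expcmnE; elim: (m i) => [|n IH] /=; first exact: mdeg1.
by rewrite mdegM IH mdegU.
Qed.

Lemma mren_mul (s : int -> int) (m n : mon) : injective s ->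
  mren s (mmul m n) = mmul (mren s m) (mren s n).
Proof.
move=> sI; apply: monP => j; rewrite monM.
have [[i <-]|h] := pselect (exists i, s i = j); first by rewrite !mrenE // monM.
by rewrite !mren_out // => i hi; apply: h; exists i.
Qed.

Lemma mren_one (s : int -> int) : injective s -> mren s mone = mone.
Proof.
move=> sI; apply: monP => j.
have [[i <-]|h] := pselect (exists i, s i = j); first by rewrite mrenE // !mon1.
by rewrite !mren_out ?mon1 // => i hi; apply: h; exists i.
Qed.

Lemma mren_ucm (s : int -> int) i : injective s -> mren s (ucm i) = ucm (s i).
Proof.
move=> sI; apply: monP => j.
have [[k <-]|h] := pselect (exists i, s i = j).
  by rewrite mrenE // !monU (inj_eq sI).
rewrite !mren_out ?monU; last by move=> k hk; apply: h; exists k.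
by case: eqP => // e; case: h; exists i.
Qed.

(** ** Products of series *)

Lemma serM (f g : series) m :
  (f * g) m = \sum_(p \in factorizations m) (f p.1 * g p.2).
Proof. by []. Qed.

Lemma ser0 m : (0 : series) m = 0. Proof. by []. Qed.
Lemma ser1 m : (1 : series) m = (m == mone)%:R. Proof. by []. Qed.
Lemma serB (f g : series) m : (f - g) m = f m - g m. Proof. by []. Qed.
Lemma serZ a (f : series) m : (a *: f) m = a * f m. Proof. by []. Qed.

Lemma ser_sum (I : Type) (r : seq I) (F : I -> series) m :
  (\sum_(i <- r) F i) m = \sum_(i <- r) F i m.
Proof.
by elim: r => [|x r IH]; rewrite ?big_nil // !big_cons seriesD IH.
Qed.

Lemma serM_neq0 (f g : series) m : (f * g) m != 0 ->
  exists a b, [/\ mmul a b = m, f a != 0 & g b != 0].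
Proof.
rewrite serM => h; apply: contrapT => n; case/eqP: h; apply: fsbig1 => -[a b] /= ab.
have [fa|fa] := eqVneq (f a) 0; first by rewrite fa mul0r.
have [gb|gb] := eqVneq (g b) 0; first by rewrite gb mulr0.
by case: n; exists a, b.
Qed.

(** Only the factorization with first factor x_i contributes, by cancellation in the monomials. With
    [XvarM0] this reduces multiplication by a variable to a shift of coefficients. *)
Lemma XvarM i (g : series) (m : mon) : (Xvar i * g) (mmul (ucm i) m) = g m.
Proof.
rewrite serM (fsbigD1 (ucm i : mon, m)) //=; last exact: finite_factorizations.
rewrite /Xvar eqxx mul1r fsbig1 ?addr0 // => -[a b] /= [ab ne].
case: eqP ab ne => [->|_ _ _]; last by rewrite mul0r.
move=> ab []; congr pair; apply: monP => j.
by have := congr1 (fun m : mon => m j) ab; rewrite !monM => /addnI.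
Qed.

Lemma XvarM0 i (g : series) (m : mon) : m i = 0%N -> (Xvar i * g) m = 0.
Proof.
move=> mi; apply/eqP/negPn/negP => /serM_neq0[a [b [ab + _]]].
rewrite /Xvar; case: (a =P _) => [ai _|]; last by rewrite eqxx.
by move: mi; rewrite -ab ai monM monU eqxx.
Qed.

Lemma const_term_mul (f g : series) : (f * g) mone = f mone * g mone.
Proof.
rewrite serM (fsbigD1 (mone : mon, mone : mon)) /=;
  [|exact: finite_factorizations|exact: mul1m].
rewrite fsbig1 ?addr0 // => -[a b] /= [ab []].
have /eqP : (mmul a b : mon) = mone by [].
by rewrite [_ == _]cmM_eq1 => /andP[/eqP -> /eqP ->].
Qed.

(** ** Renaming and restriction of variables *)

(** For injective [s] this is the substitution x_(s i) |-> x_i that sets the variables outside the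
    image of [s] to zero; hence the inverse in [ren_Xvar]. *)
Definition ren (s : int -> int) (f : series) : series := fun m => f (mren s m).

Lemma ren1 s : injective s -> ren s 1 = 1.
Proof.
move=> sI; apply: seriesP => m; rewrite /ren !ser1; congr (_%:R); congr nat_of_bool.
apply/eqP/eqP => [h|->]; last exact: mren_one.
by apply: monP => i; rewrite -(mrenE s) // h !mon1.
Qed.

Section Ren.
Variables (s t : int -> int).
Hypotheses (st : cancel s t) (ts : cancel t s).

Let sI : injective s. Proof. exact: can_inj st. Qed.
Let tI : injective t. Proof. exact: can_inj ts. Qed.

Lemma renM f g : ren s (f * g) = ren s f * ren s g.
Proof.
apply: seriesP => m; rewrite /ren serM.
rewrite (reindex_fsbig (fun p : mon * mon => (mren s p.1, mren s p.2))
  (factorizations m) (factorizations (mren s m))) //.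
have mK (u : mon) : mren s (mren t u) = u.
  by rewrite mren_comp // -[RHS]mren_id; congr mren; apply: funext.
have mK' (u : mon) : mren t (mren s u) = u.
  by rewrite mren_comp // -[RHS]mren_id; congr mren; apply: funext.
split.
- by move=> [a b] /= <-; rewrite /factorizations /= mren_mul.
- by move=> [a b] [c d] _ _ /= [/(congr1 (mren t)) + /(congr1 (mren t))];
    rewrite !mK' => -> ->.
- move=> [a b] /= ab; exists (mren t a, mren t b); rewrite ?mK //.
  have e : mmul a b = mren s m by [].
  by rewrite /factorizations /= -mren_mul // e mK'.
Qed.

Lemma ren_Xvar i : ren s (Xvar i) = Xvar (t i).
Proof.
apply: seriesP => m; rewrite /ren /Xvar; congr (_%:R); congr nat_of_bool.
apply/eqP/eqP => [h|->]; last by rewrite mren_ucm // ts.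
apply: monP => j; rewrite -(mrenE s) // h !monU.
by rewrite -(inj_eq tI) st.
Qed.

End Ren.

(** The specialization that sets the variables outside [P] to zero. *)
Definition rest (P : pred int) (f : series) : series :=
  fun m => if all P (finsupp m) then f m else 0.

Lemma all_suppP (P : pred int) (m : mon) :
  reflect (forall i, m i != 0%N -> P i) (all P (finsupp m)).
Proof.
apply: (iffP allP) => h i; first by rewrite cmE_neq0; apply: h.
by move=> im; apply: h; rewrite cmE_neq0.
Qed.

Lemma all_suppM (P : pred int) (m n : mon) :
  all P (finsupp (mmul m n)) = all P (finsupp m) && all P (finsupp n).
Proof.
apply/all_suppP/andP => [h|[/all_suppP a /all_suppP b] i]; last first.
  by rewrite monM addn_eq0 negb_and => /orP[/a|/b].
by split; apply/all_suppP => i ni; apply: h; rewrite monM addn_eq0 negb_and ni ?orbT.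
Qed.

Lemma restM P f g : rest P (f * g) = rest P f * rest P g.
Proof.
apply: seriesP => m; rewrite /rest; case: ifP => am; last first.
  rewrite serM fsbig1 // => -[a b] /= ab.
  move: am; rewrite -ab all_suppM => /negbT; rewrite negb_and.
  by move=> /orP[] /negbTE ->; rewrite ?mul0r ?mulr0.
rewrite !serM; apply: eq_fsbigr => -[a b]; rewrite inE /= => ab.
by move: am; rewrite -ab all_suppM => /andP[-> ->].
Qed.

Lemma restB P f g : rest P (f - g) = rest P f - rest P g.
Proof.
by apply: seriesP => m; rewrite serB /rest; case: ifP => // _; rewrite subr0.
Qed.

Lemma rest_Xvar (P : pred int) i : P i -> rest P (Xvar i) = Xvar i.
Proof.
move=> Pi; apply: seriesP => m; rewrite /rest /Xvar; case: ifP => //.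
move=> am; case: (m =P _) => // mi; move: am; rewrite mi => /all_suppP[] j.
by rewrite monU; case: (i =P j) => // <-.
Qed.

(** * Divided differences *)

Lemma srefK i : involutive (sref i).
Proof. by move=> j; rewrite /sref; do !case: ifP; lia. Qed.

Lemma sref_inj i : injective (sref i).
Proof. exact: inv_inj (@srefK i). Qed.

Lemma srefl i : sref i i = i + 1. Proof. by rewrite /sref eqxx. Qed.
Lemma srefr i : sref i (i + 1) = i. Proof. by rewrite /sref; do !case: ifP; lia. Qed.
Lemma srefN i j : j != i -> j != i + 1 -> sref i j = j.
Proof. by rewrite /sref => /negbTE -> /negbTE ->. Qed.

Lemma sref_comm i j : (1 < `|i - j|)%N -> sref i \o sref j = sref j \o sref i.
Proof. by move=> ij; apply: funext => k /=; rewrite /sref; do !case: ifP; lia. Qed.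

Lemma sref_braid i :
  sref i \o sref (i + 1) \o sref i = sref (i + 1) \o sref i \o sref (i + 1).
Proof.
apply: funext => k /=.
have E : sref (i + 1) i = i by rewrite srefN //; lia.
have F : sref i (i + 1 + 1) = i + 1 + 1 by rewrite srefN //; lia.
have [->|ki] := eqVneq k i; first by rewrite E srefl srefl F.
have [->|ki1] := eqVneq k (i + 1); first by rewrite srefr E !srefl F srefr.
have [->|ki2] := eqVneq k (i + 1 + 1); first by rewrite F !srefr E.
by rewrite !(srefN i) ?(srefN (i + 1)) ?(srefN i).
Qed.

Lemma mren_sref i (m : mon) j : mren (sref i) m j = m (sref i j).
Proof. by apply: mrenK; apply: srefK. Qed.

Lemma sact_zmod_morphism i : zmod_morphism (sact i).
Proof. by []. Qed.

Lemma sact_monoid_morphism i : monoid_morphism (sact i).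
Proof.
split; first exact: (ren1 _ (sref_inj i)).
exact: (renM _ _ (srefK i) (srefK i)).
Qed.

HB.instance Definition _ i :=
  GRing.isZmodMorphism.Build series series (sact i) (sact_zmod_morphism i).
HB.instance Definition _ i :=
  GRing.isMonoidMorphism.Build series series (sact i) (sact_monoid_morphism i).

Lemma sactZ i a f : sact i (a *: f) = a *: sact i f.
Proof. by []. Qed.

Lemma sactB i f g : sact i (f - g) = sact i f - sact i g.
Proof. exact: rmorphB. Qed.
Lemma sactM i f g : sact i (f * g) = sact i f * sact i g.
Proof. exact: rmorphM. Qed.

Lemma sact_Xvar i j : sact i (Xvar j) = Xvar (sref i j).
Proof. exact: (ren_Xvar _ _ (srefK i) (srefK i)). Qed.

Lemma sact_comp i j f :
  sact i (sact j f) = fun m => f (mren (sref j \o sref i) m).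
Proof. by apply: seriesP => m; rewrite /sact mren_comp //; apply: sref_inj. Qed.

Lemma sactK i : involutive (sact i).
Proof.
move=> f; rewrite sact_comp; apply: seriesP => m; congr f.
rewrite -[RHS]mren_id; congr mren; apply: funext; exact: srefK.
Qed.

Lemma sact_comm i j f : (1 < `|i - j|)%N -> sact i (sact j f) = sact j (sact i f).
Proof. by move=> ij; rewrite !sact_comp (sref_comm i j). Qed.

Lemma sact_braid i f :
  sact i (sact (i + 1) (sact i f)) = sact (i + 1) (sact i (sact (i + 1) f)).
Proof.
have I k : injective (sref k) by exact: sref_inj.
have E j k l : sact j (sact k (sact l f)) =
    fun m => f (mren (sref l \o sref k \o sref j) m).
  rewrite sact_comp; apply: seriesP => m; rewrite /sact mren_comp ?compA //.
  exact: inj_comp.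
by rewrite !E sref_braid.
Qed.

(** * Exact division by x_i - x_(i+1) *)

(** Both s_i and the division by x_i - x_(i+1) touch only these two exponents, so identities are
    checked on pairs (a, b) with the rest of [m] frozen. *)
Definition mset (i : int) (m : mon) (a b : nat) : mon :=
  CMonom [fsfun x in ([fset i; (i + 1)%R] `|` finsupp m)%fset =>
    if x == i then a else if x == i + 1 then b else m x | 0%N].

Lemma msetE i m a b j :
  mset i m a b j = if j == i then a else if j == i + 1 then b else m j.
Proof.
rewrite /mset /= fsfun_fun !inE.
case: (j == i) => //; case: (j == i + 1) => //=.
by case: ifP => // /negbT; rewrite -cmE_eq0 => /eqP.
Qed.

Lemma mset_id i m : mset i m (m i) (m (i + 1)) = m.
Proof. by apply: monP => j; rewrite msetE; do 2?case: eqP => [->|_]. Qed.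

Lemma mset_mset i m a b c d : mset i (mset i m a b) c d = mset i m c d.
Proof. by apply: monP => j; rewrite !msetE; case: ifP => // ->; case: ifP => // ->. Qed.

Lemma i1_neq (i : int) : (i + 1 == i) = false.
Proof. by lia. Qed.

Lemma msetl i m a b : mset i m a b i = a.
Proof. by rewrite msetE eqxx. Qed.

Lemma msetr i m a b : mset i m a b (i + 1) = b.
Proof. by rewrite msetE i1_neq eqxx. Qed.

Lemma mren_mset i m a b : mren (sref i) (mset i m a b) = mset i m b a.
Proof.
apply: monP => j; rewrite mren_sref !msetE.
have [->|ji] := eqVneq j i; first by rewrite srefl i1_neq eqxx.
have [->|ji1] := eqVneq j (i + 1); first by rewrite srefr eqxx.
by rewrite srefN // (negbTE ji) (negbTE ji1).
Qed.

Lemma Xvar_mset i g m a b : (Xvar i * g) (mset i m a.+1 b) = g (mset i m a b).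
Proof.
rewrite (_ : mset i m a.+1 b = mmul (ucm i) (mset i m a b)) ?XvarM //.
apply: monP => j; rewrite monM monU !msetE.
by rewrite [i == j]eq_sym; case: ifP.
Qed.

Lemma Xvar1_mset i g m a b :
  (Xvar (i + 1) * g) (mset i m a b.+1) = g (mset i m a b).
Proof.
rewrite (_ : mset i m a b.+1 = mmul (ucm (i + 1)) (mset i m a b)) ?XvarM //.
apply: monP => j; rewrite monM monU !msetE.
rewrite [i + 1 == j]eq_sym; case: ifP => [/eqP ->|_]; last by case: ifP.
by rewrite eq_sym i1_neq.
Qed.

Lemma subX_mset i g m a b : ((Xvar i - Xvar (i + 1)) * g) (mset i m a b) =
  (if a is a'.+1 then g (mset i m a' b) else 0) -
  (if b is b'.+1 then g (mset i m a b') else 0).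
Proof.
rewrite mulrBl serB; congr (_ - _).
  by case: a => [|a]; [apply: XvarM0; rewrite msetl | exact: Xvar_mset].
by case: b => [|b]; [apply: XvarM0; rewrite msetr | exact: Xvar1_mset].
Qed.

Lemma mdeg_mset i m a b :
  (mdeg (mset i m a b) + (m i + m (i + 1)%R) = mdeg m + (a + b))%N.
Proof.
pose D := ([fset i; (i + 1)%R] `|` finsupp m)%fset.
pose D' := (D `\` [fset i] `\` [fset (i + 1)%R])%fset.
have sub (n : mon) : (forall j, j \notin D -> n j = 0%N) ->
    mdeg n = (n i + (n (i + 1)%R + \sum_(j <- D') n j))%N.
  move=> h; rewrite (@mdegEw _ _ D); last first.
    by apply/fsubsetP => j; rewrite -cmE_neq0; apply: contraNT => /h ->.
  have iD : i \in D by rewrite !inE eqxx.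
  have i1D : (i + 1)%R \in (D `\` [fset i])%fset by rewrite !inE i1_neq eqxx orbT.
  by rewrite (big_fsetD1 _ iD) (big_fsetD1 _ i1D).
rewrite (sub m); last first.
  move=> j; rewrite !inE !negb_or => /andP[_].
  by rewrite -cmE_eq0 => /eqP.
rewrite (sub (mset i m a b)); last first.
  move=> j; rewrite msetE !inE !negb_or => /andP[/andP[/negbTE -> /negbTE ->]].
  by rewrite -cmE_eq0 => /eqP.
rewrite msetl msetr (_ : \sum_(j <- D') mset i m a b j = \sum_(j <- D') m j)%N.
  by lia.
rewrite big_seq [RHS]big_seq; apply: eq_bigr => j.
by rewrite !in_fsetD1 => /and3P[/negbTE ji1 /negbTE ji _]; rewrite msetE ji ji1.
Qed.

(** Let H(a, b) be the coefficient of f - s_i f at exponents a, b of x_i, x_(i+1). The quotient g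
    must satisfy g(a, b) = H(a+1, b) + g(a+1, b-1); unfolding this down to b = 0 gives the finite
    sum. *)
Definition diffquo (i : int) (f : series) : series := fun m =>
  \sum_(j < (m (i + 1)%R).+1)
    (f (mset i m (m i + 1 + j)%N (m (i + 1)%R - j)%N) -
     f (mset i m (m (i + 1)%R - j)%N (m i + 1 + j)%N)).

Lemma diffquoP i f : (Xvar i - Xvar (i + 1)) * diffquo i f = f - sact i f.
Proof.
apply: seriesP => m; rewrite serB.
pose H a b := f (mset i m a b) - f (mset i m b a).
pose S a b := \sum_(j < b.+1) H (a + j)%N (b - j)%N.
have dE a b : diffquo i f (mset i m a b) = S a.+1 b.
  rewrite /diffquo msetl msetr; apply: eq_bigr => j _.
  by rewrite !mset_mset addn1.
(* The recursion leaves one condition open, at exponent 0 of x_i. It holds because H is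
   antisymmetric, so its sum over a full antidiagonal vanishes. *)
have S0 b : S 0%N b = 0.
  have E : S 0%N b = - S 0%N b.
    rewrite {1}/S (reindex_inj rev_ord_inj) /= /S -sumrN; apply: eq_bigr => j _.
    rewrite subSS !add0n subKn; last by have := ltn_ord j; lia.
    by rewrite opprB.
  by apply/eqP; rewrite -eqNr {2}E.
have SE a b : S a b.+1 = H a b.+1 + S a.+1 b.
  rewrite /S big_ord_recl addn0 subn0; congr (_ + _); apply: eq_bigr => j _.
  by rewrite lift0 subSS addnS addSn.
have S1 a : S a 0%N = H a 0%N by rewrite /S big_ord1 addn0.
have HE : H (m i) (m (i + 1)) = f m - sact i f m.
  have e : mset i m (m (i + 1)) (m i) = mren (sref i) m.
    by rewrite -mren_mset mset_id.
  by rewrite /H mset_id e.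
clearbody S H.
have main p q : ((Xvar i - Xvar (i + 1)) * diffquo i f) (mset i m p q) = H p q.
  rewrite subX_mset; case: p => [|a]; case: q => [|b]; rewrite ?dE.
  - by rewrite subr0 -S1 S0.
  - rewrite sub0r; have := SE 0%N b; rewrite S0.
    by move=> /eqP; rewrite eq_sym addr_eq0 => /eqP ->.
  - by rewrite subr0 S1.
  - by rewrite SE addrK.
by have := main (m i) (m (i + 1)); rewrite mset_id HE.
Qed.

(** The equation at exponents (p+1, q) gives g(p, q) = g(p+1, q-1), and g(p, 0) = 0; induction on
    q. *)
Lemma subX_reg i g : (Xvar i - Xvar (i + 1)) * g = 0 -> g = 0.
Proof.
move=> h; apply: seriesP => m.
have E p q : (g (mset i m p q)) = if q is q'.+1 then g (mset i m p.+1 q') else 0.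
  by apply/eqP; rewrite -subr_eq0 -(subX_mset i g m p.+1 q) h.
rewrite -(mset_id i m).
elim: (m (i + 1)) (m i) => [|q IH] p; by rewrite E // IH.
Qed.

Lemma subX_inj i g g' :
  (Xvar i - Xvar (i + 1)) * g = (Xvar i - Xvar (i + 1)) * g' -> g = g'.
Proof.
move=> h; apply/eqP; rewrite -subr_eq0; apply/eqP/(@subX_reg i).
by rewrite mulrBr h subrr.
Qed.

Lemma ddiffP i f : (Xvar i - Xvar (i + 1)) * ddiff i f = f - sact i f.
Proof.
pose P (g : series) := (Xvar i - Xvar (i + 1)) * g = f - sact i f.
exact: (@xgetPex _ 0 P (ex_intro _ (diffquo i f) (diffquoP i f))).
Qed.

Lemma ddiff_unique i f g :
  (Xvar i - Xvar (i + 1)) * g = f - sact i f -> ddiff i f = g.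
Proof. by move=> h; apply: (@subX_inj i); rewrite ddiffP h. Qed.

Lemma ddiffE i f : ddiff i f = diffquo i f.
Proof. by apply: ddiff_unique; rewrite diffquoP. Qed.

Lemma ddiff0P i f : ddiff i f = 0 <-> sact i f = f.
Proof.
split=> h; last by apply: ddiff_unique; rewrite h mulr0 subrr.
by apply/esym/eqP; rewrite -subr_eq0 -ddiffP h mulr0.
Qed.

Lemma sactE i f : sact i f = f - (Xvar i - Xvar (i + 1)) * ddiff i f.
Proof. by rewrite ddiffP opprB addrC subrK. Qed.

Lemma ddiffD i f g : ddiff i (f + g) = ddiff i f + ddiff i g.
Proof. by apply: ddiff_unique; rewrite mulrDr !ddiffP rmorphD opprD addrACA. Qed.

Lemma ddiffZ i a f : ddiff i (a *: f) = a *: ddiff i f.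
Proof. by apply: ddiff_unique; rewrite -scalerAr ddiffP sactZ scalerBr. Qed.

Lemma ddiff0 i : ddiff i 0 = 0.
Proof. by apply/ddiff0P; rewrite rmorph0. Qed.

Lemma ddiff1 i : ddiff i 1 = 0.
Proof. by apply/ddiff0P; rewrite rmorph1. Qed.

Lemma ddiffB i f g : ddiff i (f - g) = ddiff i f - ddiff i g.
Proof. by rewrite -[- g]scaleN1r ddiffD ddiffZ scaleN1r. Qed.

Lemma ddiff_sum (I : Type) i (r : seq I) (F : I -> series) :
  ddiff i (\sum_(j <- r) F j) = \sum_(j <- r) ddiff i (F j).
Proof.
by elim: r => [|x r IH]; rewrite ?big_nil ?ddiff0 // !big_cons ddiffD IH.
Qed.

Lemma ddiffM i f g : ddiff i (f * g) = ddiff i f * g + sact i f * ddiff i g.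
Proof.
apply: ddiff_unique; rewrite mulrDr mulrA ddiffP mulrCA ddiffP sactM.
by rewrite mulrBl mulrBr addrA subrK.
Qed.

(** * Relations between divided differences over an abstract ring *)

Section DividedDifferences.
Variables (R : comNzRingType) (s d : int -> R -> R) (x : int -> R).
Hypotheses (sM : forall i f g, s i (f * g) = s i f * s i g)
  (sB : forall i f g, s i (f - g) = s i f - s i g)
  (sK : forall i f, s i (s i f) = f)
  (sC : forall i j f, (1 < `|i - j|)%N -> s i (s j f) = s j (s i f))
  (sBr : forall i f,
     s i (s (i + 1) (s i f)) = s (i + 1) (s i (s (i + 1) f)))
  (sx : forall i j, s i (x j) = x (sref i j))
  (xreg : forall i g, (x i - x (i + 1)) * g = 0 -> g = 0)
  (dP : forall i f, (x i - x (i + 1)) * d i f = f - s i f).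

Lemma dd_uniq i f g : (x i - x (i + 1)) * g = f - s i f -> d i f = g.
Proof.
move=> h; apply/eqP; rewrite -subr_eq0; apply/eqP/(xreg i).
by rewrite mulrBr dP h subrr.
Qed.

Lemma dd_sact i f : s i (d i f) = d i f.
Proof.
have := congr1 (s i) (dP i f); rewrite sM !sB !sx srefl srefr sK => h.
by apply/esym/dd_uniq; rewrite -[x i - _]opprB mulNr h opprB.
Qed.

Lemma dd_dd i f : d i (d i f) = 0.
Proof. by apply: dd_uniq; rewrite dd_sact subrr mulr0. Qed.

Lemma dd_mull i f g : s i f = f -> d i (f * g) = f * d i g.
Proof. by move=> h; apply: dd_uniq; rewrite mulrCA dP sM h mulrBr. Qed.

Lemma dd_addXl i f g : s i f = f -> s i g = g -> d i (f + x i * g) = g.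
Proof.
move=> hf hg; apply: dd_uniq.
have sD a b : s i (a + b) = s i a + s i b.
  have s0 : s i 0 = 0 by rewrite -[0 in LHS](subrr 0) sB subrr.
  by rewrite -{1}[b]opprK sB -[- b]sub0r sB s0 sub0r opprK.
by rewrite sD sM hf hg sx srefl opprD addrACA subrr add0r mulrBl.
Qed.

Lemma dd_subXr i f g : s i f = f -> s i g = g -> d i (f - x (i + 1) * g) = g.
Proof.
move=> hf hg; apply: dd_uniq.
by rewrite sB sM hf hg sx srefr opprB [RHS]addrC addrA addrNK mulrBl.
Qed.

Lemma far_subX i j : (1 < `|i - j|)%N -> s i (x j - x (j + 1)) = x j - x (j + 1).
Proof. by move=> ij; rewrite sB !sx !srefN //; lia. Qed.

Lemma dd_sC i j f : (1 < `|i - j|)%N -> s i (d j f) = d j (s i f).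
Proof.
move=> ij; apply/esym/dd_uniq; rewrite -{1}(far_subX _ _ ij) -sM dP.
by rewrite sB sC.
Qed.

(** s_j fixes x_i - x_(i+1), so this factor passes through d_j and (x_i - x_(i+1)) * d_j (d_i f)
    becomes d_j (f - s_i f). *)
Lemma dd_dC i j f : (1 < `|i - j|)%N -> d i (d j f) = d j (d i f).
Proof.
move=> ij; have ji : (1 < `|j - i|)%N by lia.
have dB g h : d j (g - h) = d j g - d j h.
  by apply: dd_uniq; rewrite mulrBr !dP sB !opprB !addrA [LHS](ACl (1*4*3*2)%AC).
apply: dd_uniq; rewrite -(dd_mull _ _ _ (far_subX _ _ ji)) dP.
by rewrite dB dd_sC.
Qed.

Section AlternatingSum.
Variables (i j : int) (a b c : R).
Hypotheses (aD : forall f, a * d i f = f - s i f)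
  (bE : forall f, b * d j f = f - s j f).
Hypotheses (abc : c - b = a) (sb : s i b = c) (sc : s i c = b) (ta : s j a = c).

(** Here [a], [b], [c] stand for the three differences of x_i, x_(i+1), x_(i+2). The hypotheses are
    kept abstract so that exchanging (i, a) with (j, b) treats the other side of the braid relation
    too. *)
Lemma alternating_sum f : a * (c * (b * d i (d j (d i f)))) =
  (f - s i f) - (s j f - s j (s i f)) + (s i (s j f) - s i (s j (s i f))).
Proof.
have L : c * (b * d j (d i f)) = c * d i f - (s j f - s j (s i f)).
  by rewrite bE mulrBr -{2}ta -sM aD sB.
have sL : s i (c * (b * d j (d i f))) =
    b * d i f - (s i (s j f) - s i (s j (s i f))).
  by rewrite L !sB sM sc dd_sact.
transitivity (c * (b * d j (d i f)) - s i (c * (b * d j (d i f)))).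
  rewrite mulrCA [a * _]mulrCA aD !sM sc sb [b * (c * _)]mulrCA.
  by rewrite !mulrBr.
have subC p q u v : u - q - (v - p) = u - v - q + p :> R.
  by rewrite opprB addrA addrAC [u - q - v]addrAC.
by rewrite sL L subC -aD -abc mulrBl.
Qed.
End AlternatingSum.

(* Multiplied by the Vandermonde product of x_i, x_(i+1), x_(i+2), either side
   is the alternating sum of the six permuted copies of [f]. *)
Lemma dd_braid i f :
  d i (d (i + 1) (d i f)) = d (i + 1) (d i (d (i + 1) f)).
Proof.
pose j := i + 1; rewrite -/j.
pose a := x i - x (i + 1); pose b := x j - x (j + 1); pose c := x i - x (j + 1).
have cb : c - b = a by rewrite /a /b /c /j opprB addrA addrNK.
have ca : c - a = b by rewrite -cb opprB addrC addrNK.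
have ij : sref i (j + 1) = j + 1 by rewrite srefN // /j; lia.
have ji : sref j i = i by rewrite srefN // /j; lia.
have sib : s i b = c by rewrite sB !sx srefr ij.
have sic : s i c = b by rewrite sB !sx srefl ij.
have sja : s j a = c by rewrite sB !sx srefl ji.
have sjc : s j c = a by rewrite sB !sx srefr ji.
(* [c] is regular because s_i carries it to the regular element [b]. *)
have regc g : c * g = 0 -> g = 0.
  move=> h; rewrite -(sK i g) (_ : s i g = 0).
    by rewrite -[0 in LHS](subrr 0) sB subrr.
  by apply: (xreg j); rewrite -/b -sic -sM h -[0 in LHS](subrr 0) sB subrr.
apply/eqP; rewrite -subr_eq0; apply/eqP/(xreg j)/regc/(xreg i).
rewrite -/a -/b !mulrBr; apply/eqP; rewrite subr_eq0; apply/eqP.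
have -> : a * (c * (b * d j (d i (d j f)))) = b * (c * (a * d j (d i (d j f)))).
  by rewrite mulrCA [RHS]mulrCA; congr (_ * _); rewrite mulrCA.
rewrite (alternating_sum i j a b c (dP i) (dP j) cb sib sic sja).
rewrite (alternating_sum j i b a c (dP j) (dP i) ca sja sjc sib) sBr -/j.
move: (s i (s j f)) (s j (s i f)) (s j (s i (s j f))) (s i f) (s j f) => p q r u v.
by rewrite !opprB !addrA [LHS](ACl (1*4*5*2*3*6)%AC).
Qed.

End DividedDifferences.

Lemma ddiff_ddiff i f : ddiff i (ddiff i f) = 0.
Proof. exact: (dd_dd _ sact ddiff Xvar sactM sactB sactK sact_Xvar subX_reg ddiffP). Qed.

Lemma ddiff_addXl i f g :
  sact i f = f -> sact i g = g -> ddiff i (f + Xvar i * g) = g.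
Proof. exact: (dd_addXl _ sact ddiff Xvar sactM sactB sact_Xvar subX_reg ddiffP). Qed.

Lemma ddiff_subXr i f g :
  sact i f = f -> sact i g = g -> ddiff i (f - Xvar (i + 1) * g) = g.
Proof. exact: (dd_subXr _ sact ddiff Xvar sactM sactB sact_Xvar subX_reg ddiffP). Qed.

Lemma sact_ddiff_comm i j f : (1 < `|i - j|)%N ->
  sact i (ddiff j f) = ddiff j (sact i f).
Proof.
exact: (dd_sC _ sact ddiff Xvar sactM sactB sact_comm sact_Xvar subX_reg ddiffP).
Qed.

Lemma ddiff_comm i j f : (1 < `|i - j|)%N ->
  ddiff i (ddiff j f) = ddiff j (ddiff i f).
Proof.
exact: (dd_dC _ sact ddiff Xvar sactM sactB sact_comm sact_Xvar subX_reg ddiffP).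
Qed.

Lemma ddiff_braid i f :
  ddiff i (ddiff (i + 1) (ddiff i f)) = ddiff (i + 1) (ddiff i (ddiff (i + 1) f)).
Proof.
exact: (dd_braid _ sact ddiff Xvar sactM sactB sactK sact_braid sact_Xvar
  subX_reg ddiffP).
Qed.

(** * Supports *)

(** Read off the summands of [diffquo]. Degree bounds, homogeneity and bounds on the variables of
    d_i f all come from here. *)
Lemma ddiff_supp i (f : series) m : ddiff i f m != 0 -> exists m' : mon,
  [/\ f m' != 0, mdeg m' = (mdeg m).+1,
      forall j, j != i -> j != i + 1 -> m' j = m j
    & (m i < m' i)%N \/ (m i < m' (i + 1)%R)%N].
Proof.
rewrite ddiffE /diffquo => h.
have [j hj] : exists j : 'I_(m (i + 1)).+1,
    f (mset i m (m i + 1 + j)%N (m (i + 1)%R - j)%N) != 0 \/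
    f (mset i m (m (i + 1)%R - j)%N (m i + 1 + j)%N) != 0.
  move/eqP: h => h; apply: contrapT => n; case: h.
  rewrite big1 => [//|j _].
  have F a : ~ (a != 0 :> rat) -> a = 0 by move=> /negP/negPn/eqP.
  rewrite (F (f (mset i m (m i + 1 + j)%N _))); last first.
    by move=> a0; apply: n; exists j; left.
  rewrite (F (f (mset i m (m (i + 1)%R - j)%N _))) ?subrr //.
  by move=> a0; apply: n; exists j; right.
have deg a b : (a + b)%N = (m i + 1 + m (i + 1)%R)%N ->
    mdeg (mset i m a b) = (mdeg m).+1.
  by move=> ab; have := mdeg_mset i m a b; rewrite ab; lia.
have ltj := ltn_ord j; case: hj => hj.
all: eexists; split; [exact: hj | by apply: deg; lia | | ].
- by move=> k /negbTE ki /negbTE ki1; rewrite msetE ki ki1.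
- by left; rewrite msetl; lia.
- by move=> k /negbTE ki /negbTE ki1; rewrite msetE ki ki1.
- by right; rewrite msetr; lia.
Qed.

Definition vars_le (N : int) (f : series) :=
  forall (m : mon) j, f m != 0 -> N < j -> m j = 0%N.

(** The symmetries s_j, s_(j+1), ... carry the nonzero exponent at j upwards until it passes N,
    where no monomial of [f] reaches. *)
Lemma sym_vars0 (p N : int) f (m : mon) (j : int) : (forall i, p <= i -> sact i f = f) ->
  vars_le N f -> p <= j -> m j != 0%N -> f m = 0.
Proof.
move=> fs fN; have [n le] : exists n : nat, N + 1 - j <= n%:Z.
  by exists `|(N + 1 - j)%R|%N; lia.
elim: n m j le => [|n IH] m j le pj mj.
  apply: contra_neq_eq mj => fm; apply: fN fm _; lia.
have [Nj|jN] := ltP N j; first by apply: contra_neq_eq mj => fm; apply: fN fm _.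
rewrite -(fs _ pj) /sact; apply: (IH _ (j + 1)); [lia|lia|].
by rewrite mren_sref srefr.
Qed.

(** * Elementary and complete homogeneous functions *)

Lemma elem_coef d k (m : mon) : elem d k m =
  `[< mdeg m = d /\ forall i, m i != 0%N -> i <= k /\ m i = 1%N >]%:R.
Proof.
congr (_%:R); congr nat_of_bool; apply/idP/idP.
  move=> /and3P[/eqP md /all_suppP h1 /all_suppP h2]; apply/asboolP; split=> // i mi.
  by split; [exact: h1 | apply/eqP/h2].
move=> /asboolP[md h]; apply/and3P; split; first exact/eqP.
  by apply/all_suppP => i /h[].
by apply/all_suppP => i /h[_ ->].
Qed.

Lemma homog_coef d k (m : mon) : homog d k m =
  `[< mdeg m = d /\ forall i, m i != 0%N -> i <= k >]%:R.
Proof.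
congr (_%:R); congr nat_of_bool; apply/idP/idP.
  by move=> /andP[/eqP md /all_suppP h]; apply/asboolP; split.
by move=> /asboolP[md h]; apply/andP; split; [exact/eqP | apply/all_suppP].
Qed.

Lemma mon_div (m : mon) k : m k != 0%N -> exists n : mon, m = mmul (ucm k) n.
Proof.
move=> mk; exists (divcm m (ucm k)); apply: monP => j.
rewrite monM divcmE monU; case: (k =P _) => [<-|_]; last by rewrite subn0.
by rewrite subnKC // lt0n.
Qed.

Lemma elemS d k : elem d.+1 k = elem d.+1 (k - 1) + Xvar k * elem d (k - 1).
Proof.
apply: seriesP => m; rewrite seriesD.
have [mk|mk] := eqVneq (m k) 0%N.
  rewrite XvarM0 // addr0 !elem_coef; congr (_%:R); congr nat_of_bool.
  apply: asbool_equiv_eq; split=> -[md h]; split=> // i mi.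
    have [ik m1] := h i mi; split=> //.
    by have : i != k by [apply: contraNneq mi => ->; rewrite mk]; lia.
  by have [ik m1] := h i mi; split=> //; lia.
rewrite [elem _ (k - 1) m]elem_coef (_ : asbool _ = false) ?add0r; last first.
  by apply/asboolP => -[_ /(_ k mk)]; lia.
have [n mn] := mon_div _ _ mk; rewrite mn XvarM !elem_coef mdegM mdegU.
congr (_%:R); congr nat_of_bool; apply: asbool_equiv_eq; split=> -[md h].
  split; first by lia.
  move=> i; have := h i; rewrite monM monU; case: (k =P _) => [<-|ki] /=.
    by move=> /(_ isT)[_ e] nk; move: e nk; lia.
  by rewrite add0n => H /H[]; lia.
split; first by rewrite md.
move=> i; rewrite monM monU; case: (k =P _) => [<- _|ki] /=.
  by have [/eqP e|/h[]] := boolP (n k == 0%N); [split; rewrite ?e|lia].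
by rewrite add0n => /h[ik n1]; split; [lia | exact: n1].
Qed.

(** Unlike in [elemS] the cofactor still contains x_k, which may be repeated. This is why d_k raises
    k on [homog] and lowers it on [elem]. *)
Lemma homogS d k : homog d.+1 k = homog d.+1 (k - 1) + Xvar k * homog d k.
Proof.
apply: seriesP => m; rewrite seriesD.
have [mk|mk] := eqVneq (m k) 0%N.
  rewrite XvarM0 // addr0 !homog_coef; congr (_%:R); congr nat_of_bool.
  apply: asbool_equiv_eq; split=> -[md h]; split=> // i mi; have := h i mi.
    by have : i != k by [apply: contraNneq mi => ->; rewrite mk]; lia.
  lia.
rewrite [homog _ (k - 1) m]homog_coef (_ : asbool _ = false) ?add0r; last first.
  by apply/asboolP => -[_ /(_ k mk)]; lia.
have [n mn] := mon_div _ _ mk; rewrite mn XvarM !homog_coef mdegM mdegU.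
congr (_%:R); congr nat_of_bool; apply: asbool_equiv_eq; split=> -[md h].
  split; first by lia.
  by move=> i ni; apply: h; rewrite monM; lia.
split; first by rewrite md.
move=> i; rewrite monM monU; case: (k =P _) => [<- //|ki] /=.
by rewrite add0n; apply: h.
Qed.

Lemma elem0 k : elem 0 k = 1.
Proof.
apply: seriesP => m; rewrite elem_coef ser1; congr (_%:R); congr nat_of_bool.
apply/asboolP/eqP => [[/mdeg_eq0I //]|->].
by split; [exact: mdeg1 | move=> i; rewrite mon1].
Qed.

Lemma homog0 k : homog 0 k = 1.
Proof.
apply: seriesP => m; rewrite homog_coef ser1; congr (_%:R); congr nat_of_bool.
apply/asboolP/eqP => [[/mdeg_eq0I //]|->].
by split; [exact: mdeg1 | move=> i; rewrite mon1].
Qed.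

Lemma Xvar_elem k : Xvar k = elem 1 k - elem 1 (k - 1).
Proof. by rewrite elemS elem0 mulr1 addrC addKr. Qed.

Lemma Xvar_homog k : Xvar k = homog 1 k - homog 1 (k - 1).
Proof. by rewrite homogS homog0 mulr1 addrC addKr. Qed.

Lemma sref_le i k j : i != k -> (sref i j <= k) = (j <= k).
Proof. by rewrite /sref; do 2?[case: ifP]; lia. Qed.

Lemma sact_elem i d k : i != k -> sact i (elem d k) = elem d k.
Proof.
move=> ik; apply: seriesP => m; rewrite /sact !elem_coef mdeg_mren.
congr (_%:R); congr nat_of_bool; apply: asbool_equiv_eq.
split=> -[md h]; split=> // j; last first.
  by rewrite mren_sref => /h; rewrite sref_le.
by have := h (sref i j); rewrite mren_sref srefK sref_le.
Qed.

Lemma sact_homog i d k : i != k -> sact i (homog d k) = homog d k.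
Proof.
move=> ik; apply: seriesP => m; rewrite /sact !homog_coef mdeg_mren.
congr (_%:R); congr nat_of_bool; apply: asbool_equiv_eq.
split=> -[md h]; split=> // j; last first.
  by rewrite mren_sref => /h; rewrite sref_le.
by have := h (sref i j); rewrite mren_sref srefK sref_le.
Qed.

Lemma ddiff_elem0 i d k : i != k -> ddiff i (elem d k) = 0.
Proof. by move=> ik; apply/ddiff0P/sact_elem. Qed.

Lemma ddiff_homog0 i d k : i != k -> ddiff i (homog d k) = 0.
Proof. by move=> ik; apply/ddiff0P/sact_homog. Qed.

Lemma ddiff_elem d k : ddiff k (elem d.+1 k) = elem d (k - 1).
Proof.
have k1 : k != k - 1 by lia.
by rewrite elemS; apply: ddiff_addXl; apply: sact_elem.
Qed.

Lemma ddiff_homog d k : ddiff k (homog d.+1 k) = homog d (k + 1).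
Proof.
have k1 : k != k + 1 by lia.
have -> : homog d.+1 k = homog d.+1 (k + 1) - Xvar (k + 1) * homog d (k + 1).
  by rewrite [homog d.+1 (k + 1)]homogS addrK addrK.
by apply: ddiff_subXr; apply: sact_homog.
Qed.

(** * Inversions of finitely supported permutations *)

Lemma finite_int_box (N : nat) : finite_set [set i : int | `|i| <= N%:Z]%classic.
Proof.
apply: (@sub_finite_set _ _ [set` [seq k%:Z - N%:Z | k <- iota 0 (N + N).+1]]%classic).
  move=> i iN; apply/mapP; move: iN; rewrite /mkset => iN.
  exists `|(i + N%:Z)%R|%N; last by lia.
  by rewrite mem_iota; lia.
exact: finite_seq.
Qed.

Lemma SZ_bound w : SZ w <->
  bijective w /\ exists N : nat, forall i, N%:Z < `|i| -> w i = i.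
Proof.
split=> -[wb]; last first.
  move=> [N wN]; split=> //; apply: sub_finite_set (finite_int_box N) => i /= wi.
  by rewrite leNgt; apply/negP => /wN.
move=> /finite_seqP[r wr]; split=> //.
exists (\sum_(i <- r) `|i|)%N => i iN; apply: contrapT => wi.
have ir : i \in r by have : [set i | w i <> i]%classic i := wi; rewrite wr.
by move: iN; rewrite (big_rem i ir) /=; lia.
Qed.

Lemma SZ_inj w : SZ w -> injective w.
Proof. by case=> /bij_inj. Qed.

Lemma SZ_id : SZ id.
Proof. by apply/SZ_bound; split; [exists id | exists 0%N]. Qed.

Lemma SZ_comp u v : SZ u -> SZ v -> SZ (u \o v).
Proof.
move=> /SZ_bound[ub [N uN]] /SZ_bound[vb [M vM]]; apply/SZ_bound; split.
  exact: bij_comp.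
by exists (maxn N M) => i iNM /=; rewrite vM ?uN //; lia.
Qed.

Lemma SZ_sref i : SZ (sref i).
Proof.
apply/SZ_bound; split; first by exists (sref i); apply: srefK.
by exists (`|i| + 1)%N => j jN; rewrite srefN //; lia.
Qed.

Lemma SZ_comp_sref w i : SZ w -> SZ (w \o sref i).
Proof. by move=> wZ; apply: SZ_comp => //; apply: SZ_sref. Qed.

Lemma comp_srefK (w : int -> int) i : (w \o sref i) \o sref i = w.
Proof. by apply: funext => j /=; rewrite srefK. Qed.

Definition inversions (w : int -> int) : set (int * int) :=
  [set p | p.1 < p.2 /\ w p.2 < w p.1]%classic.

Lemma finite_inversions w : SZ w -> finite_set (inversions w).
Proof.
move=> wZ; have wI := SZ_inj _ wZ; move/SZ_bound: wZ => [_ [N wN]].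
apply: sub_finite_set (finite_setX (finite_int_box N) (finite_int_box N)).
have fixw i : `|w i| <= N%:Z \/ w i = i.
  have [|/wN/wI] := leP (`|w i|) N%:Z; [by left | by right].
move=> [a b] [/= ab wab]; split=> /=; rewrite leNgt; apply/negP => h.
  by have := wN _ h; case: (leP `|b| N%:Z) => [|/wN]; case: (fixw b); lia.
by have := wN _ h; case: (leP `|a| N%:Z) => [|/wN]; case: (fixw a); lia.
Qed.

(** The form of Coxeter length used in the proof; [coxlenE] identifies it with the minimum over
    words. *)
Definition ell (w : int -> int) : nat := #|` fset_set (inversions w)|.

(** Relabelling positions by s_i matches the inversions of [w] with those of w s_i other than (i,
    i+1). *)
Lemma ell_asc w i : SZ w -> w i < w (i + 1) -> ell (w \o sref i) = (ell w).+1.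
Proof.
move=> wZ wi; pose phi (p : int * int) := (sref i p.1, sref i p.2).
have phiK : involutive phi by move=> [a b]; rewrite /phi /= !srefK.
have fin := finite_inversions _ wZ.
have E : inversions (w \o sref i) = ((i, i + 1) |` (phi @` inversions w))%classic.
  apply/seteqP; split=> [[a b] [/= ab wab]|[a b] /=].
    have [->|ne] := eqVneq (a, b) (i, i + 1); [by left | right].
    exists (sref i a, sref i b); last by rewrite /phi /= !srefK.
    split=> //=; move: ne; rewrite xpair_eqE /sref.
    by do ?case: ifP; lia.
  case=> [[-> ->]|[[c d] [/= cd wcd] [<- <-]]].
    by split; rewrite /= ?srefl ?srefr //; lia.
  split; rewrite /= ?srefK //.
  have [e|ne] := eqVneq (c, d) (i, i + 1).
    by case: e cd wcd => -> ->; lia.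
  move: ne cd; rewrite xpair_eqE /sref.
  by do ?case: ifP; lia.
have nin : (i, i + 1) \notin fset_set (phi @` inversions w)%classic.
  rewrite in_fset_set; last exact: finite_image.
  apply/negP; rewrite inE => -[[a b] [/= ab _] [ai bi]].
  move: ab; rewrite -(srefK i a) -(srefK i b) ai bi srefl srefr; lia.
rewrite /ell E fset_setU1; last exact: finite_image.
rewrite cardfsU1 nin add1n fset_set_image // card_imfset //.
exact: inv_inj.
Qed.

Lemma ell_desc w i : SZ w -> w (i + 1) < w i -> ell w = (ell (w \o sref i)).+1.
Proof.
move=> wZ wi; rewrite -{1}(comp_srefK w i) ell_asc //; first exact: SZ_comp_sref.
by rewrite /= srefl srefr.
Qed.

Lemma desc_or_asc w i : SZ w -> w (i + 1) < w i \/ w i < w (i + 1).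
Proof.
move=> wZ; have [||/(SZ_inj _ wZ)] := ltgtP (w (i + 1)) (w i); [by left|by right|lia].
Qed.

(** Without descents [w] is increasing, so w i - i is nondecreasing in i; it vanishes at -M and at M
    for large M, hence everywhere. *)
Lemma descent_ex w : SZ w -> w <> id -> exists i, w (i + 1) < w i.
Proof.
move=> wZ wid; apply: contrapT => n; apply: wid; apply: funext => i.
have asc j : w j + 1 <= w (j + 1).
  rewrite lezD1; case: (desc_or_asc w j wZ) => [h|//].
  by case: n; exists j.
have ascn j (k : nat) : w j + k%:Z <= w (j + k%:Z).
  elim: k => [|k IH]; first by rewrite !addr0.
  have := asc (j + k%:Z); rewrite (_ : j + k%:Z + 1 = j + k.+1%:Z); lia.
move/SZ_bound: wZ => [_ [N wN]].
pose M := (N + 1 + `|i|)%N.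
have := ascn (- M%:Z) `|(i + M%:Z)%R|%N; rewrite wN; last by lia.
rewrite (_ : - M%:Z + _ = i); last by lia.
have := ascn i `|(M%:Z - i)%R|%N; rewrite (_ : i + _ = M%:Z); last by lia.
by rewrite (wN M%:Z) /=; lia.
Qed.

Lemma SZ_ind (P : (int -> int) -> Prop) : P id ->
  (forall w i, SZ w -> w (i + 1) < w i -> P (w \o sref i) -> P w) ->
  forall w, SZ w -> P w.
Proof.
move=> P1 PS w; have [n le] := ubnP (ell w); elim: n w le => // n IH w le wZ.
have [->//|/(descent_ex _ wZ)[i wi]] := pselect (w = id).
apply: (PS w i) => //; apply: IH; last exact: SZ_comp_sref.
by move: le; rewrite (ell_desc w i).
Qed.

Lemma ell_id : ell id = 0%N.
Proof.
rewrite /ell (_ : inversions id = set0%classic) ?fset_set0 ?cardfs0 //.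
by apply/seteqP; split=> // -[a b] [/= ab ba]; lia.
Qed.

Lemma word_rcons t i : word (rcons t i) = word t \o sref i.
Proof. by elim: t => [|j t IH] //=; rewrite IH. Qed.

Lemma SZ_word t : SZ (word t).
Proof.
by elim/last_ind: t => [|t i IH]; [exact: SZ_id|rewrite word_rcons; exact: SZ_comp_sref].
Qed.

Lemma ell_word t : (ell (word t) <= size t)%N.
Proof.
elim/last_ind: t => [|t i IH]; first by rewrite ell_id.
rewrite word_rcons size_rcons; have tZ := SZ_word t.
case: (desc_or_asc (word t) i tZ) => [/ell_desc|/ell_asc] -/(_ tZ); lia.
Qed.

Lemma reduced_word w : SZ w -> exists t, size t = ell w /\ word t = w.
Proof.
elim/SZ_ind: w / => [|w i wZ wi [t [st tw]]]; first by exists [::]; rewrite ell_id.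
exists (rcons t i); rewrite size_rcons word_rcons st tw comp_srefK.
by rewrite (ell_desc w i).
Qed.

Lemma coxlenE w : SZ w -> coxlen w = ell w.
Proof.
move=> wZ; have [t [st tw]] := reduced_word _ wZ.
apply: xget_subset1 => [|k l [[u [su uw] hu]] [[v [sv vw] hv]]].
  split; first by exists t.
  by move=> u uw; rewrite -uw; apply: ell_word.
by apply/eqP; rewrite eqn_leq -{1}sv -{2}su (hu v vw) (hv u uw).
Qed.

Lemma coxlen_ltE w i : SZ w -> (coxlen (w \o sref i) < coxlen w)%N = (w (i + 1) < w i).
Proof.
move=> wZ; rewrite !coxlenE //; last exact: SZ_comp_sref.
case: (desc_or_asc w i wZ) => [h|h]; first by rewrite (ell_desc w i) // ltnSn h.
by rewrite ell_asc // ltnNge leqnSn /= [RHS]ltNge (ltW h).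
Qed.

(** * Reduced words and braid relations *)

Section NilCoxeter.
Variables (T : Type) (op : T -> T -> T) (one : T) (D : int -> T).
Hypotheses (opA : forall a b c, op a (op b c) = op (op a b) c)
  (Dcomm : forall i j, (1 < `|i - j|)%N -> op (D i) (D j) = op (D j) (D i))
  (Dbraid : forall i,
     op (op (D i) (D (i + 1))) (D i) = op (op (D (i + 1)) (D i)) (D (i + 1))).

Definition some_descent (w : int -> int) : int :=
  xget 0 [set i | w (i + 1) < w i]%classic.

Lemma some_descentP w : SZ w -> w <> id ->
  w (some_descent w + 1) < w (some_descent w).
Proof.
move=> wZ wid; have [i wi] := descent_ex _ wZ wid.
exact: (@xgetI _ 0 [set i | w (i + 1) < w i]%classic i wi).
Qed.

(** The product along the reduced word obtained by stripping a chosen descent at each step; the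
    counter is the length of [w], which each step lowers by one. [nilprodE] shows that any descent
    could have been chosen. *)
Fixpoint nilprod_rec (n : nat) (w : int -> int) : T :=
  if n is n'.+1 then
    op (nilprod_rec n' (w \o sref (some_descent w))) (D (some_descent w))
  else one.

Definition nilprod (w : int -> int) : T := nilprod_rec (ell w) w.

Lemma nilprod_id : nilprod id = one.
Proof. by rewrite /nilprod ell_id. Qed.

(* Matsumoto's theorem: two descents of [w] generate a dihedral parabolic
   subgroup whose longest element splits off [w] on the right. *)
Lemma nilprodE w i : SZ w -> w (i + 1) < w i ->
  nilprod w = op (nilprod (w \o sref i)) (D i).
Proof.
have [n le] := ubnP (ell w); elim: n w le i => // n IH w le i wZ wi.
have IHs j k : w (j + 1) < w j -> (w \o sref j) (k + 1) < (w \o sref j) k ->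
    nilprod (w \o sref j) = op (nilprod (w \o sref j \o sref k)) (D k).
  move=> wj wk; apply: IH => //; last exact: SZ_comp_sref.
  by move: le; rewrite (ell_desc w j).
have IHss j k l : w (j + 1) < w j -> (w \o sref j) (k + 1) < (w \o sref j) k ->
    (w \o sref j \o sref k) (l + 1) < (w \o sref j \o sref k) l ->
    nilprod (w \o sref j) =
      op (op (nilprod (w \o sref j \o sref k \o sref l)) (D l)) (D k).
  move=> wj wk wl; rewrite (IHs j k) //; congr op; apply: IH => //.
    move: le; rewrite (ell_desc w j) // (ell_desc _ k) //; last exact: SZ_comp_sref.
    lia.
  by do 2!apply: SZ_comp_sref.
have adj a : w (a + 1) < w a -> w (a + 1 + 1) < w (a + 1) ->
    op (nilprod (w \o sref a)) (D a) = op (nilprod (w \o sref (a + 1))) (D (a + 1)).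
  move=> w1 w2.
  have E : sref (a + 1) a = a by rewrite srefN //; lia.
  have F : sref a (a + 1 + 1) = a + 1 + 1 by rewrite srefN //; lia.
  rewrite (IHss a (a + 1) a) //=; last 2 first.
  - by rewrite F srefr; apply: lt_trans w2 w1.
  - by rewrite E !srefl F.
  rewrite (IHss (a + 1) a (a + 1)) //=; last 2 first.
  - by rewrite E srefl; apply: lt_trans w2 w1.
  - by rewrite F !srefr E.
  rewrite -!opA; congr op; last by rewrite !opA Dbraid.
  congr nilprod; exact: (congr1 (fun u => w \o u) (sref_braid a)).
have wid : w <> id by move=> e; move: wi; rewrite e; lia.
have wj := some_descentP _ wZ wid.
have -> : nilprod w =
    op (nilprod (w \o sref (some_descent w))) (D (some_descent w)).
  by rewrite {1}/nilprod (ell_desc w (some_descent w)).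
move: (some_descent w) wj => j wj.
have [->//|ij] := eqVneq j i.
have [far|near] := ltnP 1 `|(i - j)%R|.
  rewrite (IHs j i) //=; last by rewrite !srefN //; lia.
  rewrite (IHs i j) //=; last by rewrite !srefN //; lia.
  rewrite -!opA Dcomm //; congr op; congr nilprod.
  by apply: (congr1 (fun u => w \o u)); apply: sref_comm; rewrite distnC.
have [e|e] : j = i + 1 \/ i = j + 1 by lia.
  by rewrite e -adj // -e.
by rewrite e adj // -e.
Qed.

End NilCoxeter.

(** * Existence and properties of the Schubert polynomials *)

(* [ddiff_right] composes the divided differences along a reduced word of [w],
   [ddiff_left] along the reversed word. *)
Definition ddiff_right : (int -> int) -> series -> series :=
  nilprod _ (fun F G : series -> series => F \o G) id ddiff.

Definition ddiff_left : (int -> int) -> series -> series :=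
  nilprod _ (fun F G : series -> series => G \o F) id ddiff.

Lemma ddiff_comp_comm j k : (1 < `|j - k|)%N ->
  ddiff j \o ddiff k = ddiff k \o ddiff j.
Proof. by move=> jk; apply: funext => f; apply: ddiff_comm. Qed.

Lemma ddiff_comp_braid j : ddiff j \o ddiff (j + 1) \o ddiff j =
  ddiff (j + 1) \o ddiff j \o ddiff (j + 1).
Proof. by apply: funext => f; apply: ddiff_braid. Qed.

Lemma ddiff_rightE w i : SZ w -> w (i + 1) < w i ->
  ddiff_right w = ddiff_right (w \o sref i) \o ddiff i.
Proof.
exact: (nilprodE _ (fun F G : series -> series => F \o G) id ddiff
  (fun _ _ _ => erefl) ddiff_comp_comm ddiff_comp_braid w i).
Qed.

Lemma ddiff_right_asc w i : SZ w -> w i < w (i + 1) ->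
  ddiff_right w \o ddiff i = ddiff_right (w \o sref i).
Proof.
move=> wZ wi; rewrite [RHS](ddiff_rightE _ i) ?comp_srefK //.
  exact: SZ_comp_sref.
by rewrite /= srefl srefr.
Qed.

Lemma ddiff_leftE v i : SZ v -> v (i + 1) < v i ->
  ddiff_left v = ddiff i \o ddiff_left (v \o sref i).
Proof.
exact: (nilprodE _ (fun F G : series -> series => G \o F) id ddiff
  (fun _ _ _ => erefl) (fun j k jk => esym (ddiff_comp_comm j k jk))
  ddiff_comp_braid v i).
Qed.

(** * The groups S_n inside the permutations of the integers *)

Definition Sn (n : nat) (w : int -> int) : Prop :=
  [/\ SZ w, forall i, i <= 0 -> w i = i & forall i, n%:Z < i -> w i = i].

Lemma Sn_out n w i : Sn n w -> i <= 0 \/ n%:Z < i -> w i = i.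
Proof. by move=> [_ w0 wn] [/w0|/wn]. Qed.

Lemma Sn_range n w i : Sn n w -> 1 <= i <= n%:Z -> 1 <= w i <= n%:Z.
Proof.
move=> wS i1n; have wI := SZ_inj _ (let: And3 h _ _ := wS in h).
apply: contraT => h; have /wI : w (w i) = w i by apply: (Sn_out n) => //; lia.
lia.
Qed.

Lemma Sn_desc n w i : Sn n w -> w (i + 1) < w i -> 1 <= i < n%:Z.
Proof.
move=> wS; have out := Sn_out _ _ _ wS; have rg := Sn_range _ _ _ wS.
have := out i; have := out (i + 1); have := rg i; have := rg (i + 1).
by case: (leP 1 i); case: (ltP i n%:Z); lia.
Qed.

Lemma Sn_comp n u v : Sn n u -> Sn n v -> Sn n (u \o v).
Proof.
move=> [uZ u0 un] [vZ v0 vn]; split; first exact: SZ_comp.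
  by move=> i i0; rewrite /= v0 // u0.
by move=> i i0; rewrite /= vn // un.
Qed.

Lemma Sn_sref n i : 1 <= i < n%:Z -> Sn n (sref i).
Proof.
by move=> ii; split; [exact: SZ_sref | | ] => j jj; rewrite srefN //; lia.
Qed.

Lemma wlongK n : wlong n \o wlong n = id.
Proof. by apply: funext => i /=; rewrite /wlong; do ?case: ifP; lia. Qed.

Lemma Sn_wlong n : Sn n (wlong n).
Proof.
have out i : ~~ (1 <= i <= n%:Z) -> wlong n i = i.
  by rewrite /wlong; case: ifP.
split=> [|i i0|i i0]; try by apply: out; lia.
apply/SZ_bound; split.
  by exists (wlong n) => i; apply: (congr1 (fun f => f i) (wlongK n)).
by exists n => i ni; apply: out; lia.
Qed.

Lemma SinfP w : Sinf w <-> exists n, Sn n w.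
Proof.
split=> [[wZ w0]|[n [wZ w0 _]]]; last by [].
have [_ [N wN]] := (SZ_bound w).1 wZ; exists N; split=> // i Ni.
by apply: wN; lia.
Qed.

Lemma Sn_leq n p w : (n <= p)%N -> Sn n w -> Sn p w.
Proof. by move=> np [wZ w0 wn]; split=> // i ip; apply: wn; lia. Qed.

Lemma wlong_comp_asc n w i : Sn n w -> w (i + 1) < w i ->
  (wlong n \o w) i < (wlong n \o w) (i + 1).
Proof.
move=> wS wi; have i1n := Sn_desc _ _ _ wS wi.
have := Sn_range _ _ i wS; have := Sn_range _ _ (i + 1) wS.
rewrite /= /wlong; move: (w i) (w (i + 1)) wi => a b ab h1 h2.
by do ?case: ifP; lia.
Qed.

(** Induction downwards from the longest element w_0: it is [SZ_ind] for w_0 w, whose descents are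
    the ascents of [w]. *)
Lemma Sn_ind n (P : (int -> int) -> Prop) : P (wlong n) ->
  (forall w i, Sn n w -> 1 <= i < n%:Z -> w i < w (i + 1) ->
     P (w \o sref i) -> P w) ->
  forall w, Sn n w -> P w.
Proof.
move=> P1 PS w wS; rewrite -[w](_ : wlong n \o (wlong n \o w) = w); last first.
  by rewrite compA wlongK.
have : Sn n (wlong n \o w) by apply: Sn_comp => //; apply: Sn_wlong.
have [vZ _ _] : Sn n (wlong n \o w) by apply: Sn_comp => //; apply: Sn_wlong.
elim/SZ_ind: {w wS}(wlong n \o w) / vZ => [//|v i vZ vi IH vS].
have i1n := Sn_desc _ _ _ vS vi; have lS := Sn_wlong n.
apply: (PS _ i) => //; [exact: Sn_comp | exact: wlong_comp_asc|].
by apply: IH; apply: Sn_comp => //; apply: Sn_sref.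
Qed.

(** * Schubert polynomials of S_n and their independence of n *)

Definition staircase (n : nat) : series := \prod_(1 <= i < n) Xvar i%:Z ^+ (n - i).

(** The classical d_(w^-1 w_0) of the staircase monomial: [ddiff_left] runs along the reversed word
    of w_0 w, which inverts this permutation. *)
Definition schub_in (n : nat) (w : int -> int) : series :=
  ddiff_left (wlong n \o w) (staircase n).

Lemma schub_in_wlong n : schub_in n (wlong n) = staircase n.
Proof. by rewrite /schub_in wlongK /ddiff_left nilprod_id. Qed.

Lemma schub_in_desc n w i : Sn n w -> w (i + 1) < w i ->
  ddiff i (schub_in n w) = schub_in n (w \o sref i).
Proof.
move=> wS wi; have i1n := Sn_desc _ _ _ wS wi.
have [vZ _ _] : Sn n (wlong n \o w) by apply: Sn_comp => //; apply: Sn_wlong.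
rewrite /schub_in (ddiff_leftE (wlong n \o (w \o sref i)) i).
- rewrite -[(wlong n \o (w \o sref i)) \o sref i]
    /((wlong n \o w) \o sref i \o sref i).
  by rewrite comp_srefK.
- exact: SZ_comp_sref vZ.
- by have := wlong_comp_asc _ _ _ wS wi; rewrite /= srefl srefr.
Qed.

(* The monomial reached from the staircase of S_(n+1) after applying
   d_1, ..., d_k. *)
Definition stair (R : comNzRingType) (x : int -> R) (n k : nat) : R :=
  \prod_(1 <= i < n.+2) x i%:Z ^+ (n - i + (k < i <= n)).

Lemma stair0 (R : comNzRingType) (x : int -> R) n :
  stair R x n 0 = \prod_(1 <= i < n.+1) x i%:Z ^+ (n.+1 - i).
Proof.
rewrite /stair big_nat_recr //= (_ : (n - n.+1 + _)%N = 0%N); last by lia.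
rewrite expr0 mulr1; apply: eq_big_nat => i ii; congr (_ ^+ _); lia.
Qed.

Lemma stair_last (R : comNzRingType) (x : int -> R) n :
  stair R x n n = \prod_(1 <= i < n) x i%:Z ^+ (n - i).
Proof.
rewrite /stair big_nat_recr //= (_ : (n - n.+1 + _)%N = 0%N); last by lia.
rewrite expr0 mulr1; case: n => [|n]; first by rewrite !big_geq.
rewrite big_nat_recr //= (_ : (n.+1 - n.+1 + _)%N = 0%N); last by lia.
rewrite expr0 mulr1; apply: eq_big_nat => i ii; congr (_ ^+ _); lia.
Qed.

Section Staircase.
Variables (R : comNzRingType) (s : {rmorphism R -> R}) (x : int -> R) (n k : nat).
Hypotheses (kn : (k < n)%N)
  (s1 : s (x k.+1%:Z) = x k.+2%:Z) (s2 : s (x k.+2%:Z) = x k.+1%:Z)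
  (sN : forall i : nat, i != k.+1 -> i != k.+2 -> s (x i%:Z) = x i%:Z).

Local Notation stair := (stair R x n).

Let L := \prod_(1 <= i < k.+1) x i%:Z ^+ (n - i).
Let M := \prod_(k.+3 <= i < n.+2) x i%:Z ^+ (n - i + (k < i <= n)).

(** [b] records that d_(k+1) is still to be applied: the exponent of x_(k+1) then exceeds that of
    x_(k+2) by one, otherwise the two agree. *)
Lemma stairE l (b : bool) : l = (k.+1 - b)%N ->
  stair l = L * (x k.+1%:Z ^+ (n - k.+1 + b) * (x k.+2%:Z ^+ (n - k.+1) * M)).
Proof.
move=> lk; rewrite /stair (@big_cat_nat _ _ _ k.+1) //=; last by lia.
congr (_ * _); first by apply: eq_big_nat => i ik; congr (_ ^+ _); case: b lk; lia.
rewrite big_ltn; last by lia.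
congr (_ * _); first by congr (_ ^+ _); case: b lk; lia.
rewrite big_ltn; last by lia.
congr (_ * _); first by congr (_ ^+ _); case: b lk; lia.
by apply: eq_big_nat => i ik; congr (_ ^+ _); case: b lk; lia.
Qed.

Lemma stairS : stair k = x k.+1%:Z * stair k.+1.
Proof.
rewrite (stairE k true) ?subn1 // (stairE k.+1 false) ?subn0 // addn0 addn1 exprS.
by rewrite -mulrA mulrCA.
Qed.

Lemma stair_sym : s (stair k.+1) = stair k.+1.
Proof.
rewrite (stairE k.+1 false) ?subn0 // addn0 !rmorphM !rmorphXn /= s1 s2 !rmorph_prod /=.
have H a b : (forall i : nat, (a <= i < b)%N -> i != k.+1 /\ i != k.+2) ->
    forall e : nat -> nat,
    \prod_(a <= i < b) s (x i%:Z ^+ e i) = \prod_(a <= i < b) x i%:Z ^+ e i.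
  by move=> h e; apply: eq_big_nat => i /h[h1 h2]; rewrite rmorphXn /= sN.
rewrite (H 1%N k.+1); last by lia.
rewrite (H k.+3 n.+2); last by lia.
by congr (_ * _); rewrite mulrCA.
Qed.

End Staircase.

(** One-line notation n, ..., n-k+1, n+1, n-k, ..., 1: the largest value walks to the right, from
    the longest element of S_(n+1) at k = 0 to that of S_n at k = n. *)
Definition chain (n k : nat) : int -> int := fun i =>
  if 1 <= i <= k%:Z then n%:Z + 1 - i else
  if i == k%:Z + 1 then n%:Z + 1 else
  if k%:Z + 1 < i <= n%:Z + 1 then n%:Z + 2 - i else i.

Lemma chainS n k : (k < n)%N -> chain n k \o sref k.+1%:Z = chain n k.+1.
Proof.
move=> kn; apply: funext => i; rewrite /= /chain /sref; do ?case: ifP; lia.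
Qed.

Lemma chain0 n : chain n 0 = wlong n.+1.
Proof. by apply: funext => i; rewrite /chain /wlong; do ?case: ifP; lia. Qed.

Lemma chain_last n : chain n n = wlong n.
Proof. by apply: funext => i; rewrite /chain /wlong; do ?case: ifP; lia. Qed.

Lemma Sn_chain n k : (k <= n)%N -> Sn n.+1 (chain n k).
Proof.
elim: k => [|k IH] kn; first by rewrite chain0; apply: Sn_wlong.
rewrite -chainS //; apply: Sn_comp; first by apply: IH; lia.
by apply: Sn_sref; lia.
Qed.

Lemma schub_in_chain n k : (k <= n)%N ->
  schub_in n.+1 (chain n k) = stair _ Xvar n k.
Proof.
elim: k => [|k IH] kn.
  by rewrite chain0 schub_in_wlong stair0.
have desc : chain n k (k.+1%:Z + 1) < chain n k k.+1%:Z.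
  by rewrite /chain; do ?case: ifP; lia.
rewrite -chainS // -schub_in_desc //; last by apply: Sn_chain; lia.
rewrite IH; last by lia.
rewrite stairS // -[X in ddiff _ X]add0r; apply: ddiff_addXl; first exact: rmorph0.
have k2 : k.+1%:Z + 1 = k.+2%:Z by lia.
apply: stair_sym => //.
- by rewrite /= sact_Xvar srefl k2.
- by rewrite /= sact_Xvar -k2 srefr.
- by move=> i i1 i2; rewrite /= sact_Xvar srefN //; lia.
Qed.

(** At the longest element of S_n this is the chain d_1, ..., d_n, which turns the larger staircase
    into the smaller one. Divided differences carry the equality down to every other element. *)
Lemma schub_inS n w : Sn n w -> schub_in n.+1 w = schub_in n w.
Proof.
move: w; apply: Sn_ind.
  by rewrite schub_in_wlong -chain_last schub_in_chain // stair_last.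
move=> w i wS i1n wi IH.
have wsS : Sn n (w \o sref i) by apply: Sn_comp => //; apply: Sn_sref.
have w1 : (w \o sref i) (i + 1) < (w \o sref i) i by rewrite /= srefl srefr.
have := schub_in_desc n.+1 _ i (Sn_leq _ n.+1 _ (leqnSn n) wsS) w1.
by rewrite IH // (schub_in_desc n) // comp_srefK => <-.
Qed.

Lemma schub_in_leq n p w : Sn n w -> (n <= p)%N -> schub_in p w = schub_in n w.
Proof.
move=> wS /subnK <-; elim: (p - n)%N => // k IH.
by rewrite addSn schub_inS //; apply: Sn_leq wS; apply: leq_addl.
Qed.

Lemma schubert_familyP : schubert_family schubert.
Proof.
apply: (@xgetPex _ _ [set F | schubert_family F]%classic).
pose F w := xget 0 [set f | exists2 n, Sn n w & f = schub_in n w]%classic.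
(* The choice of n made inside [F] is harmless by stability in n. *)
have FE n w : Sn n w -> F w = schub_in n w.
  move=> wS; apply: xget_unique => [|f [p wp ->]]; first by exists n.
  by case: (leqP n p) => [/schub_in_leq ->|/ltnW/schub_in_leq <-].
exists F; split=> [n|w i /SinfP[n wS]].
  by rewrite (FE n); [exact: schub_in_wlong | exact: Sn_wlong].
rewrite coxlen_ltE; last by case: wS.
move=> wi; rewrite (FE n) // schub_in_desc // (FE n) //.
by apply: Sn_comp => //; apply: Sn_sref; apply: Sn_desc wi.
Qed.

Lemma schubert_desc w i : Sinf w -> w (i + 1) < w i ->
  ddiff i (schubert w) = schubert (w \o sref i).
Proof.
move=> wS wi; have [_ H] := schubert_familyP; apply: H => //.
by rewrite coxlen_ltE //; case: wS.
Qed.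

Lemma schubertE n w : Sn n w -> schubert w = schub_in n w.
Proof.
move: w; apply: Sn_ind.
  by rewrite schub_in_wlong; have [H _] := schubert_familyP; apply: H.
move=> w i wS i1n wi IH.
have wsS : Sn n (w \o sref i) by apply: Sn_comp => //; apply: Sn_sref.
have w1 : (w \o sref i) (i + 1) < (w \o sref i) i by rewrite /= srefl srefr.
have wsI : Sinf (w \o sref i) by apply/SinfP; exists n.
by have := schub_in_desc n _ i wsS w1; rewrite -IH // schubert_desc // comp_srefK.
Qed.

Lemma Sinf_sref w i : Sinf w -> 1 <= i -> Sinf (w \o sref i).
Proof.
move=> /SinfP[n wS] i1; apply/SinfP; exists (n + `|i| + 1)%N.
apply: Sn_comp; first by apply: Sn_leq wS; lia.
by apply: Sn_sref; lia.
Qed.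

(** The polynomial is itself d_i of the one for w s_i, and d_i squares to zero; 1 <= i keeps w s_i
    in [Sinf]. *)
Lemma schubert_asc w i : Sinf w -> 1 <= i -> w i < w (i + 1) ->
  ddiff i (schubert w) = 0.
Proof.
move=> wS i1 wi; rewrite -(comp_srefK w i) -schubert_desc ?ddiff_ddiff //.
  exact: Sinf_sref.
by rewrite /= srefl srefr.
Qed.

Lemma schubert_id : schubert id = 1.
Proof.
have [H _] := schubert_familyP; have := H 0%N; rewrite big_geq //.
by rewrite (_ : wlong 0 = id) //; apply: funext => i; rewrite /wlong; case: ifP; lia.
Qed.

Definition vars_in (P : pred int) (f : series) :=
  forall (m : mon) i, f m != 0 -> m i != 0%N -> P i.

Lemma vars_in_mul P f g : vars_in P f -> vars_in P g -> vars_in P (f * g).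
Proof.
move=> fP gP m i /serM_neq0[a [b [<- fa gb]]].
by rewrite monM addn_eq0 negb_and => /orP[]; [apply: fP | apply: gP].
Qed.

Lemma vars_in1 P : vars_in P 1.
Proof.
by move=> m i; rewrite ser1; case: (m =P _) => [->|_]; rewrite ?mon1 ?eqxx.
Qed.

Lemma vars_in_ddiff (P : pred int) i f :
  P i -> P (i + 1) -> vars_in P f -> vars_in P (ddiff i f).
Proof.
move=> Pi Pi1 fP m j /ddiff_supp[m' [fm' _ out _]] mj.
have [->//|ji] := eqVneq j i; have [->//|ji1] := eqVneq j (i + 1).
by apply: (fP m') => //; rewrite out.
Qed.

Definition homogeneous (d : nat) (f : series) := forall m, f m != 0 -> mdeg m = d.

Lemma homogeneous_mul d e f g :
  homogeneous d f -> homogeneous e g -> homogeneous (d + e) (f * g).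
Proof.
by move=> fd ge m /serM_neq0[a [b [<- fa gb]]]; rewrite mdegM fd ?ge.
Qed.

Lemma homogeneous1 : homogeneous 0 1.
Proof.
by move=> m; rewrite ser1; case: (m =P _) => [->|_]; rewrite ?mdeg1 ?eqxx.
Qed.

Lemma homogeneous_ddiff d i f : homogeneous d f -> homogeneous d.-1 (ddiff i f).
Proof. by move=> fd m /ddiff_supp[m' [/fd <- -> _ _]]. Qed.

Lemma schubert_vars n w : Sn n w -> vars_in (fun i => 1 <= i <= n%:Z) (schubert w).
Proof.
move: w; apply: Sn_ind.
  rewrite (schubertE n) ?schub_in_wlong; last exact: Sn_wlong.
  rewrite /staircase big_seq; elim/big_ind: _ => [||i].
  - exact: vars_in1.
  - exact: vars_in_mul.
  rewrite mem_index_iota => ii; elim: (n - i)%N => [|k IH]; first exact: vars_in1.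
  rewrite exprS; apply: vars_in_mul => // m j; rewrite /Xvar.
  case: (m =P _) => [->|_]; rewrite ?eqxx // monU.
  by case: (i%:Z =P j) => // <-; lia.
move=> w i wS i1n wi IH; rewrite -(comp_srefK w i) -schubert_desc.
- by apply: vars_in_ddiff IH; lia.
- by apply: Sinf_sref; [apply/SinfP; exists n | lia].
- by rewrite /= srefl srefr.
Qed.

Lemma schubert_homogeneous w : Sinf w -> exists d, homogeneous d (schubert w).
Proof.
move=> /SinfP[n]; move: w; apply: Sn_ind.
  rewrite (schubertE n) ?schub_in_wlong; last exact: Sn_wlong.
  rewrite /staircase; elim/big_ind: _ => [|f g [d fd] [e ge]|i _].
  - by exists 0%N; apply: homogeneous1.
  - by exists (d + e)%N; apply: homogeneous_mul.
  elim: (n - i)%N => [|k [d IH]]; first by exists 0%N; apply: homogeneous1.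
  exists (1 + d)%N; rewrite exprS; apply: homogeneous_mul => // m; rewrite /Xvar.
  by case: (m =P _) => [->|_]; rewrite ?eqxx // mdegU.
move=> w i wS i1n wi [d IH]; exists d.-1; rewrite -(comp_srefK w i) -schubert_desc.
- exact: homogeneous_ddiff.
- by apply: Sinf_sref; [apply/SinfP; exists n | lia].
- by rewrite /= srefl srefr.
Qed.

Lemma Sinf_desc w i : Sinf w -> w (i + 1) < w i -> 1 <= i.
Proof. by move=> /SinfP[n wS] /(Sn_desc _ _ _ wS)/andP[]. Qed.

Lemma ser_neq0 (f : series) : f <> 0 -> exists m, f m != 0.
Proof.
move=> f0; apply: contrapT => n; apply: f0; apply: seriesP => m.
by apply/eqP/negPn/negP => fm; apply: n; exists m.
Qed.

(** Downward induction gives homogeneity of an unspecified degree. Going up from the identity, the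
    nonzero d_i of the polynomial fixes that degree, so both claims are proved together. *)
Lemma schubert_deg_neq0 w : SZ w -> Sinf w ->
  schubert w <> 0 /\ homogeneous (ell w) (schubert w).
Proof.
elim/SZ_ind: w / => [_|w i wZ wi IH wS].
  rewrite schubert_id ell_id; split; last exact: homogeneous1.
  by apply/eqP/oner_neq0.
have [|n0 hd] := IH; first by apply: Sinf_sref => //; apply: Sinf_desc wi.
move: n0 hd; rewrite -schubert_desc // => n0 hd; split.
  by move=> h; apply: n0; rewrite h ddiff0.
have [m /[dup] /hd md /ddiff_supp[m' [fm' dm' _ _]]] := ser_neq0 _ n0.
have [d fd] := schubert_homogeneous _ wS.
by rewrite (ell_desc w i) // -md -dm' (fd _ fm').
Qed.

Lemma schubert_const w : Sinf w -> schubert w mone = `[< w = id >]%:R.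
Proof.
move=> wS; have [wZ _] := wS; case: asboolP => [->|wid].
  by rewrite schubert_id ser1 eqxx.
apply/eqP/negPn/negP; have [_ h /h] := schubert_deg_neq0 _ wZ wS.
rewrite mdeg1; have [i wi] := descent_ex _ wZ wid.
by rewrite (ell_desc w i).
Qed.

(** * Back stable limits *)

Definition shiftP (c : int) (w : int -> int) : int -> int := fun i => w (i - c) + c.
(** The substitution x_(i+c) |-> x_i, inverse to the c-fold shift of variables; [shiftP c] is the
    c-fold shift of permutations. *)
Definition shift (c : int) : series -> series := ren (fun i => i + c).

Lemma iter_gammaP k w : iter k gammaP w = shiftP k%:Z w.
Proof.
elim: k => [|k IH]; apply: funext => i; first by rewrite /= /shiftP subr0 addr0.
by rewrite iterS IH /gammaP /shiftP -addrA -[i - 1 - _]addrA; congr (w _ + _); lia.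
Qed.

Lemma addcK (c : int) : cancel (fun i => i + c) (fun i => i - c).
Proof. by move=> i; rewrite addrK. Qed.
Lemma subcK (c : int) : cancel (fun i => i - c) (fun i => i + c).
Proof. by move=> i; rewrite subrK. Qed.
Lemma addc_inj (c : int) : injective (fun i : int => i + c).
Proof. exact: can_inj (addcK c). Qed.

Lemma mren_shift c (m : mon) i : mren (fun i => i + c) m i = m (i - c).
Proof. by apply: (mrenK _ (fun i => i - c)); [apply: addcK | apply: subcK]. Qed.

Lemma iter_gammaV k f : iter k gammaV f = shift k%:Z f.
Proof.
elim: k => [|k IH]; apply: seriesP => m; rewrite /shift /ren.
  by congr f; apply: monP => i; rewrite mren_shift subr0.
rewrite iterS IH /gammaV /shift /ren; congr f; apply: monP => i.
by rewrite !mren_shift; congr (m _); lia.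
Qed.

Lemma shiftB c f g : shift c (f - g) = shift c f - shift c g.
Proof. by []. Qed.

Lemma shiftM c f g : shift c (f * g) = shift c f * shift c g.
Proof. exact: (renM _ _ (addcK c) (subcK c)). Qed.

Lemma shift_Xvar c i : shift c (Xvar (i + c)) = Xvar i.
Proof. by rewrite /shift (ren_Xvar _ _ (addcK c) (subcK c)) addrK. Qed.

Lemma sact_shift c i f : sact i (shift c f) = shift c (sact (i + c) f).
Proof.
apply: seriesP => m; apply: (congr1 f).
rewrite (mren_comp _ _ m (addc_inj c) (sref_inj i)).
rewrite (mren_comp _ _ m (sref_inj (i + c)) (addc_inj c)).
apply: (congr1 (fun u => mren u m)); apply: funext => j /=.
by rewrite /sref; do ?case: ifP; lia.
Qed.

(** Carries the defining identity of a divided difference through a homomorphism; applied to [shift]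
    and to [rest]. *)
Lemma morph_subM (R : comNzRingType) (phi : R -> R) (a b a' b' g h : R) :
  (forall u v, phi (u * v) = phi u * phi v) ->
  (forall u v, phi (u - v) = phi u - phi v) ->
  phi a = a' -> phi b = b' -> (a - b) * g = h -> (a' - b') * phi g = phi h.
Proof. by move=> phiM phiB <- <- <-; rewrite phiM phiB. Qed.

Lemma ddiff_shift c i f : ddiff i (shift c f) = shift c (ddiff (i + c) f).
Proof.
apply: ddiff_unique; rewrite sact_shift.
have e : shift c (Xvar (i + c + 1)) = Xvar (i + 1).
  by rewrite addrAC; apply: shift_Xvar.
exact: (morph_subM _ _ _ _ _ _ _ _ (shiftM c) (shiftB c) (shift_Xvar c i) e
  (ddiffP (i + c) f)).
Qed.

Lemma rest_sact (P : pred int) i f : P i -> P (i + 1) ->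
  sact i (rest P f) = rest P (sact i f).
Proof.
move=> Pi Pi1; apply: seriesP => m; rewrite /sact /rest.
have Ps j : P (sref i j) = P j.
  have [->|ji] := eqVneq j i; first by rewrite srefl Pi Pi1.
  have [->|ji1] := eqVneq j (i + 1); first by rewrite srefr Pi Pi1.
  by rewrite srefN.
rewrite (_ : all P (finsupp (mren (sref i) m)) = all P (finsupp m)) //.
apply/all_suppP/all_suppP => h j mj; rewrite -Ps; apply: h; rewrite ?mren_sref ?srefK //.
by rewrite mren_sref in mj.
Qed.

Lemma ddiff_rest (P : pred int) i f : P i -> P (i + 1) ->
  ddiff i (rest P f) = rest P (ddiff i f).
Proof.
move=> Pi Pi1; apply: ddiff_unique; rewrite rest_sact // -restB.
exact: (morph_subM _ _ _ _ _ _ _ _ (restM P) (restB P) (rest_Xvar _ _ Pi)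
  (rest_Xvar _ _ Pi1) (ddiffP i f)).
Qed.

Lemma shift_rest c (P Q : pred int) f : (forall i, P (i + c) = Q i) ->
  shift c (rest P f) = rest Q (shift c f).
Proof.
move=> PQ; apply: seriesP => m; rewrite /shift /ren /rest.
rewrite (_ : all P _ = all Q (finsupp m)) //.
apply/all_suppP/all_suppP => h i; last first.
  by rewrite mren_shift => /h; rewrite -PQ subrK.
by move=> mi; rewrite -PQ; apply: h; rewrite mren_shift addrK.
Qed.

Lemma shiftP_comp c w i : shiftP c w \o sref (i + c) = shiftP c (w \o sref i).
Proof.
apply: funext => j; rewrite /shiftP /=; congr (w _ + c).
by rewrite /sref; do ?case: ifP; lia.
Qed.

Lemma shiftP_lt c w i : (shiftP c w (i + c + 1) < shiftP c w (i + c)) = (w (i + 1) < w i).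
Proof. by rewrite /shiftP addrK (addrAC i c) addrK ltrD2r. Qed.

Lemma shiftP_gt c w i : (shiftP c w (i + c) < shiftP c w (i + c + 1)) = (w i < w (i + 1)).
Proof. by rewrite /shiftP addrK (addrAC i c) addrK ltrD2r. Qed.

Lemma SZ_shiftP c w : SZ w -> SZ (shiftP c w).
Proof.
move=> /SZ_bound[[v wv vw] [N wN]]; apply/SZ_bound; split.
  by exists (shiftP c v) => i; rewrite /shiftP addrK ?wv ?vw subrK.
by exists (N + `|c|)%N => i iN; rewrite /shiftP wN ?subrK //; lia.
Qed.

Lemma shiftP_id c : shiftP c id = id.
Proof. by apply: funext => i; rewrite /shiftP subrK. Qed.

Lemma shiftP_eqid c w : shiftP c w = id -> w = id.
Proof.
move=> h; apply: funext => i; have := congr1 (fun u => u (i + c)) h.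
by rewrite /shiftP addrK => /addIr.
Qed.

Lemma ell_shiftP c w : SZ w -> ell (shiftP c w) = ell w.
Proof.
elim/SZ_ind: w / => [|w i wZ wi IH]; first by rewrite shiftP_id.
rewrite (ell_desc w i) // -IH -shiftP_comp -ell_desc //; first exact: SZ_shiftP.
by rewrite shiftP_lt.
Qed.

Lemma Sinf_gammaP n w : Sn n w -> Sn n.+1 (shiftP 1 w).
Proof.
move=> [wZ w0 wn]; split; first exact: SZ_shiftP.
  by move=> i i0; rewrite /shiftP w0; lia.
by move=> i ni; rewrite /shiftP wn; lia.
Qed.

(** By induction on length both sides have the same d_i for i >= 1. Their difference is therefore
    symmetric in x_1, x_2, ... with variables bounded above, hence constant, and the constant terms
    agree. *)
Lemma schubert_stable w : Sinf w ->
  rest (fun i => 0 < i) (shift 1 (schubert (shiftP 1 w))) = schubert w.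
Proof.
have [l le] := ubnP (ell w); elim: l w le => // l IH w le wS.
have [n wn] := (SinfP w).1 wS; have [wZ _] := wS.
have gS := Sinf_gammaP _ _ wn; have gI : Sinf (shiftP 1 w) by apply/SinfP; exists n.+1.
set G := rest _ _.
have dG i : 1 <= i -> ddiff i (G - schubert w) = 0.
  move=> i1; rewrite ddiffB /G ddiff_rest; [|lia|lia]; rewrite ddiff_shift.
  have [wi|wi] := desc_or_asc w i wZ.
    rewrite schubert_desc ?shiftP_lt // shiftP_comp schubert_desc //.
    rewrite IH ?subrr //; last exact: Sinf_sref.
    by move: le; rewrite (ell_desc w i).
  rewrite schubert_asc ?shiftP_gt //; last by lia.
  rewrite (schubert_asc w) // subr0; apply: seriesP => m.
  by rewrite /rest /shift /ren !ser0; case: ifP.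
have Gvars : vars_le n%:Z (G - schubert w).
  move=> m j; rewrite serB => h nj; apply/eqP/negPn/negP => mj; case/negP: h.
  rewrite [X in _ - X](_ : _ = 0) ?subr0; last first.
    by apply/eqP/negPn/negP => /(schubert_vars _ _ wn)/(_ mj); lia.
  rewrite /G /rest; case: ifP => // _; rewrite /shift /ren.
  apply/negPn/negP => /(schubert_vars _ _ gS _ (j + 1)).
  by rewrite mren_shift addrK => /(_ mj); lia.
apply/eqP; rewrite -subr_eq0; apply/eqP/seriesP => m; rewrite ser0.
have [->|/mon_neq1[j mj]] := eqVneq m mone.
  rewrite serB /G /rest /shift /ren (_ : all _ _ = true); last first.
    by apply/all_suppP => i; rewrite mon1.
  rewrite mren_one; last exact: addc_inj.
  rewrite !schubert_const //; case: asboolP => [/shiftP_eqid ->|].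
    by case: asboolP; rewrite ?subrr.
  by case: asboolP => [->|]; rewrite ?subrr // shiftP_id.
(* A monomial containing some x_j with j >= 1 is excluded by symmetry; one containing some x_j with
   j <= 0 occurs in neither series. *)
have [j1|j0] := leP 1 j.
  apply: (sym_vars0 1 n%:Z _ _ j) => // i i1; apply/ddiff0P; exact: dG.
rewrite serB /G /rest; case: ifP => [/all_suppP/(_ j mj)|_]; first by lia.
rewrite sub0r; apply/eqP; rewrite oppr_eq0; apply/negPn/negP.
by move=> /(schubert_vars _ _ wn)/(_ mj); lia.
Qed.

Definition bapprox (k : nat) (w : int -> int) : series :=
  shift k%:Z (schubert (shiftP k%:Z w)).

Definition above (k : nat) : pred int := fun i => - k%:Z < i.

Lemma SZ_shift_Sn w : SZ w -> exists N : nat,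
  forall k, (N < k)%N -> Sn (N + k) (shiftP k%:Z w).
Proof.
move=> wZ; have [_ [N wN]] := (SZ_bound w).1 wZ; exists N => k Nk.
split; first exact: SZ_shiftP.
  by move=> i i0; rewrite /shiftP wN ?subrK //; lia.
by move=> i ik; rewrite /shiftP wN ?subrK //; lia.
Qed.

Lemma bapproxS k w : Sinf (shiftP k%:Z w) ->
  rest (above k) (bapprox k.+1 w) = bapprox k w.
Proof.
move=> wS; rewrite /bapprox -(schubert_stable _ wS).
rewrite (shift_rest _ _ (above k)); last by move=> i; rewrite /above; lia.
rewrite (_ : shiftP 1 (shiftP k%:Z w) = shiftP k.+1%:Z w); last first.
  by apply: funext => i; rewrite /shiftP -addrA; congr (w _ + _); lia.
apply: seriesP => m; rewrite /rest; case: ifP => // _; rewrite /shift /ren.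
by congr (schubert _ _); apply: monP => i; rewrite !mren_shift; congr (m _); lia.
Qed.

Lemma above_leq k l (m : mon) : (k <= l)%N ->
  all (above k) (finsupp m) -> all (above l) (finsupp m).
Proof. by move=> kl; apply: sub_all => i; rewrite /above; lia. Qed.

Lemma mon_above (m : mon) : exists k, all (above k) (finsupp m).
Proof.
exists (\sum_(i <- finsupp m) `|i| + 1)%N; apply/allP => i im.
by rewrite /above (big_rem i im) /=; lia.
Qed.

(** By [bapproxS] all later approximants agree on monomials in the variables above -k. [K] depends
    on [w] alone, so equality holds for the whole truncation [rest (above k)], to which divided
    differences can be applied. *)
Lemma bschubert_coef w : SZ w -> exists K, forall k, (K <= k)%N ->
  [/\ Sinf (shiftP k%:Z w) &
      forall m : mon, all (above k) (finsupp m) -> bschubert w m = bapprox k w m].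
Proof.
move=> wZ; have [N hN] := SZ_shift_Sn _ wZ; exists N.+1.
have SI k : (N < k)%N -> Sinf (shiftP k%:Z w).
  by move=> Nk; apply/SinfP; exists (N + k)%N; apply: hN.
move=> k Nk; split=> [|m mk]; first exact: SI.
have stab l : (k <= l)%N -> bapprox l w m = bapprox k w m.
  move=> /subnK <-; elim: (l - k)%N => // d IH; rewrite -IH addSn.
  rewrite -[RHS](congr1 (fun f : series => f m) (bapproxS _ _ _)); last by apply: SI; lia.
  rewrite /rest; case: ifP => // /negP[]; apply: above_leq mk; exact: leq_addl.
have E l : iter l gammaV (schubert (iter l gammaP w)) m = bapprox l w m.
  by rewrite iter_gammaV iter_gammaP.
apply: xget_subset1 => [|a b [M hM] [M' hM']].
  by exists k => l kl _; rewrite E stab.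
pose l := maxn k (maxn M M').
have lS : Sinf (iter l gammaP w) by rewrite iter_gammaP; apply: SI; lia.
by rewrite -(hM l _ lS) ?(hM' l _ lS) //; lia.
Qed.

(** Truncation commutes with d_i as soon as it keeps both x_i and x_(i+1); this accounts for the
    term in [i] in the bound. *)
Lemma bschubert_ddiff_coef w i : SZ w -> exists K, forall k, (K <= k)%N ->
  [/\ Sinf (shiftP k%:Z w), 1 <= i + k%:Z &
   forall m : mon, all (above k) (finsupp m) ->
     ddiff i (bschubert w) m =
       shift k%:Z (ddiff (i + k%:Z) (schubert (shiftP k%:Z w))) m].
Proof.
move=> wZ; have [K hK] := bschubert_coef _ wZ; exists (K + `|i| + 2)%N => k Kk.
have [|SI E] := hK k; first by lia.
split=> //; first by lia.
have R : rest (above k) (bschubert w) = rest (above k) (bapprox k w).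
  by apply: seriesP => m; rewrite /rest; case: ifP => // /E.
move=> m mk; have [ik ik1] : above k i /\ above k (i + 1) by rewrite /above; lia.
have r f : f m = rest (above k) f m by rewrite /rest mk.
by rewrite r -ddiff_rest // R ddiff_rest // -r /bapprox ddiff_shift.
Qed.

Lemma bschubert_desc w i : SZ w -> w (i + 1) < w i ->
  ddiff i (bschubert w) = bschubert (w \o sref i).
Proof.
move=> wZ wi; apply: seriesP => m.
have [K hK] := bschubert_ddiff_coef _ i wZ.
have [L hL] := bschubert_coef _ (SZ_comp_sref _ i wZ).
have [M mM] := mon_above m; pose k := (K + L + M)%N.
have [|SI ik ->] := hK k; [by lia| |by apply: above_leq mM; lia].
have [|_ ->] := hL k; [by lia| |by apply: above_leq mM; lia].
by rewrite /bapprox schubert_desc ?shiftP_lt // shiftP_comp.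
Qed.

Lemma bschubert_asc w i : SZ w -> w i < w (i + 1) -> ddiff i (bschubert w) = 0.
Proof.
move=> wZ wi; apply: seriesP => m.
have [K hK] := bschubert_ddiff_coef _ i wZ.
have [M mM] := mon_above m; pose k := (K + M)%N.
have [|SI ik ->] := hK k; [by lia| |by apply: above_leq mM; lia].
by rewrite schubert_asc ?shiftP_gt.
Qed.

Lemma bschubert_const w : SZ w -> bschubert w mone = `[< w = id >]%:R.
Proof.
move=> wZ; have [K hK] := bschubert_coef _ wZ.
have [|SI ->] := hK K; [by []| |by apply/all_suppP => i; rewrite mon1].
rewrite /bapprox /shift /ren mren_one; last exact: addc_inj.
rewrite schubert_const //; congr (_%:R); congr nat_of_bool; apply: asbool_equiv_eq.
by split=> [/shiftP_eqid|->]; rewrite ?shiftP_id.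
Qed.

Lemma bschubert_homogeneous w : SZ w -> homogeneous (ell w) (bschubert w).
Proof.
move=> wZ m; have [K hK] := bschubert_coef _ wZ; have [M mM] := mon_above m.
have [|SI ->] := hK (K + M)%N; [by lia| |by apply: above_leq mM; lia].
have [_ hd] := schubert_deg_neq0 _ (SZ_shiftP (K + M)%N%:Z _ wZ) SI.
by move=> /hd; rewrite mdeg_mren ell_shiftP.
Qed.

(** * A class of back stable series closed under divided differences *)

(** The last clause is symmetry in the x_i with i <= -N. The three conditions pass visibly to
    products, combinations and divided differences, and together imply membership in [back_ring];
    one bound serves all three so that two series can share it. *)
Definition nice_at (N : nat) (f : series) :=
  [/\ forall m, f m != 0 -> (mdeg m <= N)%N, vars_le N%:Z f
    & forall i, i < - N%:Z -> sact i f = f].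

Definition nice (f : series) := exists N, nice_at N f.

Lemma bschubert_nice w : SZ w -> nice (bschubert w).
Proof.
move=> wZ; have [N hN] := SZ_shift_Sn _ wZ.
have [_ [M wM]] := (SZ_bound w).1 wZ; exists (ell w + N + M + 1)%N; split.
- by move=> m /(bschubert_homogeneous _ wZ) ->; lia.
- move=> m j; have [K hK] := bschubert_coef _ wZ; have [L mL] := mon_above m.
  have [|SI ->] := hK (K + L + N.+1)%N; [by lia| |by apply: above_leq mL; lia].
  move=> h Nj; apply/eqP/negPn/negP => mj.
  have := schubert_vars _ _ (hN (K + L + N.+1)%N _) _ (j + (K + L + N.+1)%N%:Z) h.
  by rewrite mren_shift addrK => /(_ _ mj); lia.
- move=> i iN; apply/ddiff0P; apply: bschubert_asc => //.
  by rewrite !wM; lia.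
Qed.

Lemma nice_at_leq N M f : (N <= M)%N -> nice_at N f -> nice_at M f.
Proof.
move=> NM [fd fv fs]; split.
- by move=> m /fd; lia.
- by move=> m j fm Mj; apply: fv fm _; lia.
- by move=> i iM; apply: fs; lia.
Qed.

Lemma nice2 f g : nice f -> nice g -> exists N, nice_at N f /\ nice_at N g.
Proof.
move=> [N fN] [M gM]; exists (N + M)%N.
by split; [apply: nice_at_leq fN | apply: nice_at_leq gM]; lia.
Qed.

Lemma nice_mul f g : nice f -> nice g -> nice (f * g).
Proof.
move=> fN gN; have [N [[fd fv fs] [gd gv gs]]] := nice2 _ _ fN gN.
exists (N + N)%N; split.
- by move=> m /serM_neq0[a [b [<- /fd ? /gd ?]]]; rewrite mdegM; lia.
- move=> m j /serM_neq0[a [b [<- fa gb]]] Nj.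
  by rewrite monM (fv a j fa) ?(gv b j gb) //; lia.
- by move=> i iN; rewrite sactM fs ?gs //; lia.
Qed.

Lemma nice_lin a f g : nice f -> nice g -> nice (a *: f + g).
Proof.
move=> fN gN; have [N [[fd fv fs] [gd gv gs]]] := nice2 _ _ fN gN.
have cases m : (a *: f + g) m != 0 -> f m != 0 \/ g m != 0.
  rewrite seriesD serZ; have [->|fm _] := eqVneq (f m) 0; last by left.
  by rewrite mulr0 add0r; right.
exists N; split.
- by move=> m /cases[/fd|/gd].
- by move=> m j /cases[fm|gm] Nj; [apply: fv Nj | apply: gv Nj].
- by move=> i iN; rewrite rmorphD /= sactZ fs ?gs.
Qed.

Lemma niceB f g : nice f -> nice g -> nice (f - g).
Proof. by move=> fN gN; rewrite addrC -scaleN1r; apply: nice_lin. Qed.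

Lemma nice0 : nice 0.
Proof.
by exists 0%N; split=> [m|m j|i _]; rewrite ?ser0 ?eqxx //; apply: rmorph0.
Qed.

Lemma nice_elem d k : nice (elem d k).
Proof.
exists (d + `|k| + 1)%N; split.
- move=> m; rewrite elem_coef; case: asboolP => [[md _] _|_]; first by lia.
  by rewrite eqxx.
- move=> m j; rewrite elem_coef; case: asboolP => [[_ h] _|_]; last by rewrite eqxx.
  by move=> jk; apply/eqP/negPn/negP => /h[]; lia.
- by move=> i ik; apply: sact_elem; lia.
Qed.

Lemma nice_homog d k : nice (homog d k).
Proof.
exists (d + `|k| + 1)%N; split.
- move=> m; rewrite homog_coef; case: asboolP => [[md _] _|_]; first by lia.
  by rewrite eqxx.
- move=> m j; rewrite homog_coef; case: asboolP => [[_ h] _|_]; last by rewrite eqxx.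
  by move=> jk; apply/eqP/negPn/negP => /h; lia.
- by move=> i ik; apply: sact_homog; lia.
Qed.

Lemma nice_ddiff i f : nice f -> nice (ddiff i f).
Proof.
move=> [N [fd fv fs]]; exists (N + `|i| + 2)%N; split.
- by move=> m /ddiff_supp[m' [/fd + dm _ _]]; lia.
- move=> m j /ddiff_supp[m' [fm' _ out _]] jN.
  by rewrite -out; [apply: fv fm' _; lia | lia | lia].
- by move=> j jN; rewrite sact_ddiff_comm ?fs //; lia.
Qed.

Lemma nice_eq0 f : nice f -> (forall i, ddiff i f = 0) -> f mone = 0 -> f = 0.
Proof.
move=> [N [_ fv _]] f0 f1; apply: seriesP => m; rewrite ser0.
have [->//|/mon_neq1[j mj]] := eqVneq m mone.
apply: (sym_vars0 j N%:Z _ _ j) => // i _; apply/ddiff0P; exact: f0.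
Qed.

(** * Membership in the back stable ring *)

Lemma back_ring0 : back_ring 0.
Proof. by exists [::]; split=> //; rewrite big_nil. Qed.

Lemma back_ringD f g : back_ring f -> back_ring g -> back_ring (f + g).
Proof.
move=> [s [hs ->]] [t [ht ->]]; exists (s ++ t); rewrite big_cat; split=> // p.
by rewrite mem_cat => /orP[/hs|/ht].
Qed.

Lemma mulr_sumX (R : comNzRingType) (x : R) (s : seq (R * R)) :
  x * (\sum_(p <- s) p.1 * p.2) =
  \sum_(p <- [seq (p.1, x * p.2) | p <- s]) p.1 * p.2.
Proof.
by rewrite big_map mulr_sumr; apply: eq_bigr => p _; rewrite /= mulrCA.
Qed.

Lemma back_ringX i f : back_ring f -> back_ring (Xvar i * f).
Proof.
move=> [s [hs ->]]; exists [seq (p.1, Xvar i * p.2) | p <- s].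
split; last exact: mulr_sumX.
move=> p /mapP[q /hs[q1 q2] ->]; split=> //.
apply: sub_finite_set (finite_image (mmul (ucm i)) q2) => m /=.
move=> /serM_neq0[a [b [<- Xa qb]]]; exists b => //.
by move: Xa; rewrite /Xvar; case: (a =P _) => [->|_] //; rewrite eqxx.
Qed.

Definition quoX (c : int) (f : series) : series := fun m => f (mmul (ucm c) m).

(** f - g vanishes at x_c = 0, so x_c divides it. In both inductions below, [g] is a simpler series
    and the quotient has lower degree. *)
Lemma peel c (f g : series) : (forall m : mon, m c = 0%N -> f m = g m) ->
  f = g + Xvar c * quoX c (f - g).
Proof.
move=> fg; apply: seriesP => m; rewrite seriesD.
have [mc|/mon_div[n ->]] := eqVneq (m c) 0%N; first by rewrite XvarM0 // addr0 fg.
rewrite XvarM /quoX serB addrC; move: (f _) (g _) => a b.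
by rewrite subrK.
Qed.

Lemma sact_quoX c i f : i != c -> i + 1 != c -> sact i f = f ->
  sact i (quoX c f) = quoX c f.
Proof.
move=> ic ic1 fi; apply: seriesP => m; rewrite /quoX -{2}fi /sact.
rewrite mren_mul; last exact: sref_inj.
by rewrite mren_ucm ?srefN //; [rewrite eq_sym|rewrite eq_sym|apply: sref_inj].
Qed.

Lemma Lambda_minus_sym f : bounded_degree f -> vars_le 0 f ->
  (forall i, i < 0 -> sact i f = f) -> Lambda_minus f.
Proof.
move=> fd fv fs; split=> // [m fm i i0|w wZ]; first exact: fv fm i0.
elim/SZ_ind: w / wZ => [_ m|w i wZ wi IH w0 m]; first by rewrite mren_id.
(* For i >= 0 a descent would give w i > i + 1 > 0, a point fixed by [w], against injectivity. *)
have i0 : i < 0.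
  rewrite ltNge; apply/negP => i0; move: wi; rewrite (w0 (i + 1)); last by lia.
  by move=> h; have := SZ_inj _ wZ _ _ (w0 (w i) _); lia.
have ws j : 0 < j -> (w \o sref i) j = j.
  by move=> j0; rewrite /= srefN ?w0 //; lia.
have wsI := SZ_inj _ (SZ_comp_sref _ i wZ).
have := IH ws (mren (sref i) m).
rewrite (mren_comp _ _ m wsI (sref_inj i)) comp_srefK => ->.
exact: (congr1 (fun g : series => g m) (fs _ i0)).
Qed.

(** [ren (squash c)] sets x_c to zero and renames x_i to x_(i+1) for i < c. A series symmetric in
    the x_i with i < c becomes symmetric in those with i <= c and keeps its value at x_c = 0; for
    instance e_d(c-1) becomes e_d(c). *)
Definition squash (c : int) (i : int) : int := if i <= c then i - 1 else i.

Lemma squash_inj c : injective (squash c).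
Proof. by move=> i j; rewrite /squash; do 2!case: ifP; lia. Qed.

Lemma squashS c : squash c = sref (c - 1) \o squash (c - 1).
Proof.
by apply: funext => i; rewrite /squash /sref /=; do ?case: ifP; lia.
Qed.

Lemma mren_squash_out c (m : mon) i : c < i -> mren (squash c) m i = m i.
Proof.
move=> ci; have {1}-> : i = squash c i by rewrite /squash; case: ifP; lia.
by rewrite mrenE //; apply: squash_inj.
Qed.

Lemma sact_squash c i f : i < c -> sact (i - 1) f = f ->
  sact i (ren (squash c) f) = ren (squash c) f.
Proof.
move=> ic fi; apply: seriesP => m; rewrite /sact /ren -[in RHS]fi /sact.
rewrite (mren_comp _ _ m (squash_inj c) (sref_inj i)).
rewrite (mren_comp _ _ m (sref_inj (i - 1)) (squash_inj c)).
apply: (congr1 (fun u => f (mren u m))); apply: funext => j.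
by rewrite /squash /sref /=; do ?case: ifP; lia.
Qed.

(** [squash] unrolls into adjacent transpositions that fix [f]; a monomial has finitely many
    variables, so after finitely many of them the rest acts trivially. *)
Lemma ren_squash c f (m : mon) : (forall i, i < c - 1 -> sact i f = f) ->
  m c = 0%N -> f m = ren (squash c) f m.
Proof.
move=> fs mc; rewrite /ren.
have step (n : nat) : f (mren (squash (c - 1)) m) = f (mren (squash (c - 1 - n%:Z)) m).
  elim: n => [|n ->]; first by rewrite subr0.
  rewrite squashS -mren_comp; [|exact: sref_inj|exact: squash_inj].
  rewrite -[X in X = _]/(sact (c - 1 - n%:Z - 1) f _) fs; last by lia.
  by congr (f (mren (squash _) m)); lia.
(* s_(c-1) is not among the assumed symmetries, but [m] does not contain x_c, so the first unrolling
   changes nothing. *)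
have -> : mren (squash c) m = mren (squash (c - 1)) m.
  apply: monP => j; rewrite !mren_sum big_seq [RHS]big_seq; apply: eq_bigr => i.
  rewrite -cmE_neq0 => mi; congr (_ * nat_of_bool (_ == _))%N.
  have ic : i != c by apply: contraNneq mi => ->; rewrite mc.
  by rewrite /squash; do 2!case: ifP; lia.
have [k hk] := mon_above m.
rewrite (step (k + `|c|)%N); congr f; apply: monP => j.
rewrite mren_sum -[in LHS](mren_id m) mren_sum big_seq [RHS]big_seq.
apply: eq_bigr => i im; congr (_ * nat_of_bool (_ == _))%N.
by have /allP/(_ i im) := hk; rewrite /above /squash; case: ifP; lia.
Qed.

(** Peel off x_c with c the first variable outside the symmetric range: the squashed series is
    symmetric in one more variable (induction on M), the quotient has lower degree (inner
    induction). At M = 0 the series lies in [Lambda_minus]. *)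
Lemma low_back_ring M f : bounded_degree f -> vars_le 0 f ->
  (forall i, i < - M%:Z -> sact i f = f) -> back_ring f.
Proof.
elim: M f => [|M IHM] f.
  move=> fd fv fs; exists [:: (f, 1)]; rewrite big_seq1 mulr1; split=> // p.
  rewrite inE => /eqP -> /=; split.
    by apply: Lambda_minus_sym => // i i0; apply: fs; lia.
  apply: (@sub_finite_set _ _ [set (mone : mon)]%classic); last exact: finite_set1.
  by move=> m /=; rewrite ser1; case: (m =P _) => // _; rewrite eqxx.
move=> [d fd]; have {fd} : forall m, f m != 0 -> (mdeg m < d.+1)%N by move=> m /fd.
elim: {d}d.+1 f => [|d IHd] f fd fv fs.
  rewrite (_ : f = 0); first exact: back_ring0.
  by apply: seriesP => m; apply/eqP/negPn/negP => /fd.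
pose c : int := - M%:Z.
have rd m : ren (squash c) f m != 0 -> (mdeg m < d.+1)%N.
  by move=> /fd; rewrite mdeg_mren.
have rv : vars_le 0 (ren (squash c) f).
  by move=> m j fm j0; rewrite -(mren_squash_out c); [apply: fv fm j0 | lia].
have rs i : i < - M%:Z -> sact i (ren (squash c) f) = ren (squash c) f.
  by move=> iM; apply: sact_squash => //; apply: fs; lia.
have diff m : (f - ren (squash c) f) m != 0 -> f m != 0 \/ ren (squash c) f m != 0.
  rewrite serB; have [->|fm _] := eqVneq (f m) 0; last by left.
  by rewrite sub0r oppr_eq0; right.
rewrite (peel c f (ren (squash c) f)); last first.
  by move=> m mc; apply: ren_squash => // i ic; apply: fs; lia.
apply: back_ringD; first by apply: IHM => //; exists d.+1 => m /rd/ltnW.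
apply: back_ringX; apply: IHd.
- move=> m; rewrite /quoX => h; suff : (mdeg (mmul (ucm c) m : mon) < d.+1)%N.
    by rewrite mdegM mdegU.
  by case: (diff _ h) => [/fd|/rd].
- move=> m j; rewrite /quoX => h j0.
  have : (mmul (ucm c) m : mon) j = 0%N.
    by case: (diff _ h) => [/fv|/rv]; apply.
  by rewrite monM => /eqP; rewrite addn_eq0 => /andP[_ /eqP].
- move=> i iM; apply: sact_quoX; [lia|lia|].
  by rewrite sactB fs // rs //; lia.
Qed.

(** The same double induction removes the positive variables: setting x_(N+1) to zero lowers N, the
    quotient lowers the degree. *)
Lemma sym_back_ring M N d f : (forall m, f m != 0 -> (mdeg m < d)%N) ->
  (forall i, i < - M%:Z -> sact i f = f) -> vars_le N%:Z f -> back_ring f.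
Proof.
elim: N d f => [|N IHN] d f.
  by move=> fd fs fv; apply: (low_back_ring M) => //; exists d => m /fd/ltnW.
elim: d f => [|d IHd] f fd fs fv.
  rewrite (_ : f = 0); first exact: back_ring0.
  by apply: seriesP => m; apply/eqP/negPn/negP => /fd.
pose c : int := N.+1%:Z.
pose g := rest (fun i => i != c) f.
have gf m : g m != 0 -> f m != 0 by rewrite /g /rest; case: ifP => //; rewrite eqxx.
have gs i : i < - M%:Z -> sact i g = g.
  by move=> iM; rewrite /g rest_sact ?fs //; lia.
have diff m : (f - g) m != 0 -> f m != 0.
  rewrite serB; apply: contra_neq => fm; suff -> : g m = 0 by rewrite fm subr0.
  by apply/eqP/negPn/negP => /gf; rewrite fm eqxx.
rewrite (peel c f g); last first.
  move=> m mc; rewrite /g /rest (_ : all _ _ = true) //; apply/all_suppP => i.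
  by apply: contraNneq => ->; rewrite mc.
apply: back_ringD.
  apply: (IHN d.+1) => // [m /gf/fd//|m j gm Nj].
  have [jc|jc] := eqVneq j c; last by apply: (fv _ _ (gf _ gm)); lia.
  move: gm; rewrite /g /rest; case: ifP => [/all_suppP h _|]; last by rewrite eqxx.
  by apply/eqP/negPn/negP => /h; rewrite jc eqxx.
apply: back_ringX; apply: IHd.
- by move=> m /diff/fd; rewrite mdegM mdegU.
- move=> i iM; apply: sact_quoX; [lia|lia|].
  by rewrite sactB fs // gs.
- move=> m j /diff h Nj; have := fv _ _ h Nj.
  by rewrite monM => /eqP; rewrite addn_eq0 => /andP[_ /eqP].
Qed.

Lemma nice_back_ring f : nice f -> back_ring f.
Proof. by move=> [N [fd fv fs]]; apply: (sym_back_ring N N N.+1). Qed.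

(** * Expansion in the back stable Schubert basis *)

Lemma nice_sum (I : eqType) (r : seq I) (a : I -> rat) (F : I -> series) :
  (forall i, i \in r -> nice (F i)) -> nice (\sum_(i <- r) a i *: F i).
Proof.
elim: r => [_|i r IH FN]; first by rewrite big_nil; apply: nice0.
rewrite big_cons; apply: nice_lin; first by apply: FN; rewrite mem_head.
by apply: IH => j jr; apply: FN; rewrite inE jr orbT.
Qed.

Lemma ddiff_right_id f : ddiff_right id f = f.
Proof. by rewrite /ddiff_right nilprod_id. Qed.

Lemma ddiff_right0 w : SZ w -> ddiff_right w 0 = 0.
Proof.
elim/SZ_ind: w / => [|w i wZ wi IH]; first exact: ddiff_right_id.
by rewrite (ddiff_rightE _ i) //= ddiff0.
Qed.

Lemma ddiff_right_desc w i f : SZ w -> w (i + 1) < w i ->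
  ddiff_right w (ddiff i f) = 0.
Proof.
move=> wZ wi; rewrite (ddiff_rightE _ i) //= ddiff_ddiff ddiff_right0 //.
exact: SZ_comp_sref.
Qed.

Lemma ddiff_deg n i f : (forall m, f m != 0 -> (mdeg m < n.+1)%N) ->
  forall m, ddiff i f m != 0 -> (mdeg m < n)%N.
Proof. by move=> fd m /ddiff_supp[m' [/fd + dm _ _]]; rewrite dm. Qed.

(** Far to the left [f] is symmetric; far to the right it contains neither x_i nor x_(i+1). *)
Lemma nice_ddiff_far f : nice f -> exists N : nat, forall i, N%:Z < `|i| ->
  ddiff i f = 0.
Proof.
move=> [N [_ fv fs]]; exists N => i iN; apply/ddiff0P.
have [/fs //|i0] := ltP i (- N%:Z).
apply: seriesP => m; rewrite /sact.
have [mi|mi] := boolP ((m i == 0%N) && (m (i + 1) == 0%N)).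
  congr f; apply: monP => j; rewrite mren_sref.
  case/andP: mi => /eqP mi /eqP mi1.
  have [->|ji] := eqVneq j i; first by rewrite srefl mi mi1.
  have [->|ji1] := eqVneq j (i + 1); first by rewrite srefr mi mi1.
  by rewrite srefN.
have z (m' : mon) : (m' i != 0%N) || (m' (i + 1) != 0%N) -> f m' = 0.
  move=> h; apply/eqP/negPn/negP => fm; move: h.
  by rewrite (fv _ _ fm) ?(fv _ _ fm) //; lia.
rewrite (z m) -?negb_and // z // !mren_sref srefl srefr orbC -negb_and //.
Qed.

(** Supplies classical equality on functions, so that permutations can be listed in sequences. *)
Definition SZtype := {classic int -> int}.

(** Any w other than the identity has a descent i, and d_w f = d_(w s_i) (d_i f). Only finitely many
    d_i f are nonzero, and each has lower degree. *)
Lemma ddiff_right_finite n f : nice f -> (forall m, f m != 0 -> (mdeg m < n)%N) ->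
  exists s : seq SZtype, forall w, SZ w -> ddiff_right w f <> 0 -> (w : SZtype) \in s.
Proof.
elim: n f => [|n IH] f fN fd.
  exists [::] => w wZ; have -> : f = 0.
    by apply: seriesP => m; apply/eqP/negPn/negP => /fd.
  by rewrite ddiff_right0.
have [N hN] := nice_ddiff_far _ fN.
have /choice[S hS] : forall i, exists s : seq SZtype, forall w, SZ w ->
    ddiff_right w (ddiff i f) <> 0 -> (w : SZtype) \in s.
  by move=> i; apply: IH; [apply: nice_ddiff | apply: ddiff_deg].
pose E i : seq SZtype := [seq (v : int -> int) \o sref i : SZtype | v <- S i].
exists ((id : SZtype) :: flatten [seq E (k%:Z - N%:Z) | k <- iota 0 (N + N).+1]).
move=> w wZ wf; rewrite inE; apply/orP.
have [->|/(descent_ex _ wZ)[i wi]] := pselect (w = id); [by left | right].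
rewrite (ddiff_rightE _ i wZ wi) in wf.
have iN : `|i| <= N%:Z.
  rewrite leNgt; apply/negP => /hN h; apply: wf.
  by rewrite [LHS]/comp h ddiff_right0 //; apply: SZ_comp_sref.
apply/flattenP; exists (E i).
  apply/mapP; exists `|(i + N%:Z)%R|%N; first by rewrite mem_iota; lia.
  by congr E; lia.
apply/mapP; exists ((w \o sref i) : SZtype); last by rewrite comp_srefK.
by apply: hS => //; apply: SZ_comp_sref.
Qed.

(** Applying d_i to the right side keeps the [w] with a descent at i and replaces them by w s_i,
    which is the expansion of d_i f. The difference is thus killed by every d_i, and its constant
    term is 0 since only the identity contributes one. *)
Lemma nice_expansion n f (s : seq SZtype) : nice f ->
  (forall m, f m != 0 -> (mdeg m < n)%N) -> uniq s -> (forall w, w \in s -> SZ w) ->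
  (forall w, SZ w -> ddiff_right w f <> 0 -> (w : SZtype) \in s) ->
  f = \sum_(w <- s) ddiff_right w f mone *: bschubert w.
Proof.
elim: n f s => [|n IH] f s fN fd su sZ fs.
  have f0 : f = 0 by apply: seriesP => m; apply/eqP/negPn/negP => /fd.
  rewrite big_seq big1 // => w /sZ wZ; rewrite {1}f0 ddiff_right0 // ser0.
  exact: scale0r.
pose G := \sum_(w <- s) ddiff_right w f mone *: bschubert w.
have GN : nice G by apply: nice_sum => w /sZ; apply: bschubert_nice.
apply/eqP; rewrite -subr_eq0; apply/eqP; apply: nice_eq0.
- exact: niceB.
- move=> i; rewrite ddiffB; apply/eqP; rewrite subr_eq0; apply/eqP.
  pose s' : seq SZtype :=
    [seq (w : int -> int) \o sref i : SZtype | w <- s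
      & (w : int -> int) (i + 1) < (w : int -> int) i].
  rewrite (IH (ddiff i f) s'); last 5 first.
  + exact: nice_ddiff.
  + exact: ddiff_deg.
  + rewrite map_inj_uniq ?filter_uniq // => u v.
    move=> /(congr1 (fun w : int -> int => w \o sref i)).
    by rewrite !comp_srefK.
  + by move=> w /mapP[v]; rewrite mem_filter => /andP[_ /sZ vZ] ->; apply: SZ_comp_sref.
  (* If [v] has a descent at i then d_v d_i = 0; otherwise d_v d_i = d_(v s_i), so v s_i is already
     listed in [s]. *)
  + move=> v vZ vf; have [vi|vi] := desc_or_asc v i vZ.
      by case: vf; apply: ddiff_right_desc.
    apply/mapP; exists ((v \o sref i) : SZtype); last by rewrite comp_srefK.
    rewrite mem_filter /= srefl srefr vi /=; apply: fs; first exact: SZ_comp_sref.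
    by rewrite -ddiff_right_asc.
  rewrite /G ddiff_sum big_map big_filter big_mkcond /=.
  rewrite big_seq [RHS]big_seq; apply: eq_bigr => w /sZ wZ.
  rewrite ddiffZ; have [wi|wi] := desc_or_asc w i wZ.
    by rewrite wi bschubert_desc // (ddiff_rightE _ i wZ wi).
  rewrite bschubert_asc // scaler0 ltNge (ltW wi) //.
- rewrite serB ser_sum; apply/eqP; rewrite subr_eq0; apply/eqP.
  have idE w : w \in s -> (ddiff_right w f mone *: bschubert w) mone =
      if w == (id : SZtype) then f mone else 0.
    move=> /sZ wZ; rewrite serZ bschubert_const //.
    case: (w =P (id : SZtype)) => [->|wid].
      by rewrite ddiff_right_id; case: asboolP => [_|//]; rewrite mulr1.
    by case: asboolP => [//|_]; rewrite mulr0.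
  rewrite big_seq (eq_bigr _ idE) -big_seq -big_mkcond /=.
  have [ids|ids] := boolP ((id : SZtype) \in s).
    rewrite -big_filter filter_pred1_uniq // big_seq1 //.
  rewrite big_seq_cond big1; last first.
    by move=> w /andP[ws /eqP e]; move: ids; rewrite -e ws.
  have [-> //|f0] := pselect (f = 0).
  by case/negP: ids; apply: fs; [exact: SZ_id | rewrite ddiff_right_id].
Qed.

(** * The Dynkin reversal *)

Lemma hatPK : involutive hatP.
Proof. by move=> w; apply: funext => i; rewrite /hatP !subKr. Qed.

Lemma SZ_hatP w : SZ w -> SZ (hatP w).
Proof.
move=> /SZ_bound[[v wv vw] [N wN]]; apply/SZ_bound; split.
  by exists (hatP v) => i; rewrite /hatP subKr ?wv ?vw subKr.
by exists N.+1 => i iN; rewrite /hatP wN ?subKr //; lia.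
Qed.

Lemma hatP_sref w i : hatP (w \o sref i) = hatP w \o sref (- i).
Proof.
apply: funext => j; rewrite /hatP /=; congr (1 - w _).
by rewrite /sref; do ?case: ifP; lia.
Qed.

Lemma hatP_lt w i : (hatP w (- i + 1) < hatP w (- i)) = (w (i + 1) < w i).
Proof.
rewrite /hatP opprK [1 + i]addrC (_ : 1 - (- i + 1) = i); last by lia.
by rewrite ltrD2l ltrN2.
Qed.

Lemma hatP_gt w i : (hatP w (- i) < hatP w (- i + 1)) = (w i < w (i + 1)).
Proof.
rewrite /hatP opprK [1 + i]addrC (_ : 1 - (- i + 1) = i); last by lia.
by rewrite ltrD2l ltrN2.
Qed.

Lemma hatP_id : hatP id = id.
Proof. by apply: funext => i; rewrite /hatP subKr. Qed.

Lemma bschubert_hat_const w : SZ w -> bschubert (hatP w) mone = bschubert w mone.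
Proof.
move=> wZ; rewrite !bschubert_const //; last exact: SZ_hatP.
congr (_%:R); congr nat_of_bool; apply: asbool_equiv_eq.
by split=> [h|->]; [rewrite -(hatPK w) h hatP_id | exact: hatP_id].
Qed.

(* The graph of the ring homomorphism sending e_d(x_i, i <= k) to
   h_d(x_i, i <= - k), before it is known to be a function. *)
Inductive reversal : series -> series -> Prop :=
| Reversal0 : reversal 0 0
| ReversalGen d k : reversal (elem d k) (homog d (- k))
| ReversalLin a f f' g g' :
    reversal f f' -> reversal g g' -> reversal (a *: f + g) (a *: f' + g')
| ReversalMul f f' g g' :
    reversal f f' -> reversal g g' -> reversal (f * g) (f' * g').

Lemma reversalB f f' g g' :
  reversal f f' -> reversal g g' -> reversal (f - g) (f' - g').
Proof.
move=> ff gg; rewrite -scaleN1r -[X in reversal _ (_ - X)]scale1r -scaleNr.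
by rewrite addrC [X in reversal _ X]addrC; apply: ReversalLin.
Qed.

Lemma reversalD f f' g g' :
  reversal f f' -> reversal g g' -> reversal (f + g) (f' + g').
Proof.
move=> ff gg; rewrite -[f]scale1r -[f']scale1r; exact: ReversalLin.
Qed.

Lemma reversal_const f g : reversal f g -> f mone = g mone.
Proof.
elim=> [//|d k|a f1 f2 g1 g2 _ ef _ eg|f1 f2 g1 g2 _ ef _ eg].
- rewrite elem_coef homog_coef; congr (_%:R); congr nat_of_bool.
  apply: asbool_equiv_eq.
  by split=> -[md _]; split=> // i; rewrite mon1.
- by rewrite !seriesD !serZ ef eg.
- by rewrite !const_term_mul ef eg.
Qed.

Lemma reversal_nice f g : reversal f g -> nice g.
Proof.
elim=> [|d k|a f1 f2 g1 g2 _ ef _ eg|f1 f2 g1 g2 _ ef _ eg].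
- exact: nice0.
- exact: nice_homog.
- exact: nice_lin.
- exact: nice_mul.
Qed.

Lemma subr_sub0 (V : zmodType) (u v : V) : u - v = (0 - v) - (0 - u).
Proof. by rewrite !sub0r opprK addrC. Qed.

Lemma reversal_Xvar k : reversal (Xvar k) (0 - Xvar (- k + 1)).
Proof.
have E : 0 - Xvar (- k + 1) = homog 1 (- k) - homog 1 (- (k - 1)).
  have -> : - (k - 1) = - k + 1 by lia.
  by rewrite [Xvar (- k + 1)]Xvar_homog (addrK 1 (- k)) sub0r opprB.
by rewrite E Xvar_elem; apply: reversalB; apply: ReversalGen.
Qed.

(** The signs in x_i |-> - x_(1-i) and x_(i+1) |-> - x_(-i) turn one divisor into the other, which
    makes the Leibniz rules of d_i and d_(-i) correspond. *)
Lemma reversal_subX i :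
  reversal (Xvar i - Xvar (i + 1)) (Xvar (- i) - Xvar (- i + 1)).
Proof.
apply: (eq_ind_r (reversal _) _ (subr_sub0 _ _ _)); apply: reversalB.
  exact: reversal_Xvar.
by have := reversal_Xvar (i + 1); rewrite (_ : - (i + 1) + 1 = - i); last by lia.
Qed.

Lemma reversal_ddiff i f g : reversal f g -> reversal (ddiff i f) (ddiff (- i) g).
Proof.
elim=> [|d k|a f1 f2 g1 g2 _ ef _ eg|f1 f2 g1 g2 rf ef rg eg].
- rewrite !ddiff0; exact: Reversal0.
- have [->|ik] := eqVneq i k; last first.
    rewrite ddiff_elem0 // ddiff_homog0; first exact: Reversal0.
    by rewrite eqr_opp.
  case: d => [|d].
    rewrite elem0 homog0 !ddiff1; exact: Reversal0.
  rewrite ddiff_elem ddiff_homog (_ : - k + 1 = - (k - 1)); last by lia.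
  exact: ReversalGen.
- rewrite !ddiffD !ddiffZ; exact: ReversalLin.
(* Writing s_i f as f - (x_i - x_(i+1)) * d_i f spares a separate proof that the pairs are stable
   under (s_i, s_(-i)). *)
- rewrite !ddiffM !sactE; apply: reversalD; apply: ReversalMul => //.
  by apply: reversalB => //; apply: ReversalMul => //; apply: reversal_subX.
Qed.

(** Terms with an ascent stay in the sum with coefficient 0 and permutation [id], so the index type
    survives the induction; the same new data serve both sides. *)
Lemma ddiff_comb n i (c : 'I_n -> rat) (u : 'I_n -> int -> int) :
  (forall j, SZ (u j)) ->
  let c' j := if u j (i + 1) < u j i then c j else 0 in
  let u' j := if u j (i + 1) < u j i then u j \o sref i else id in
  ddiff i (\sum_j c j *: bschubert (u j)) = \sum_j c' j *: bschubert (u' j) /\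
  ddiff (- i) (\sum_j c j *: bschubert (hatP (u j))) =
    \sum_j c' j *: bschubert (hatP (u' j)).
Proof.
move=> uZ c' u'; rewrite !ddiff_sum; split; apply: eq_bigr => j _.
  rewrite ddiffZ /c' /u'; have [h|h] := desc_or_asc (u j) i (uZ j).
    by rewrite h bschubert_desc.
  by rewrite ltNge (ltW h) /= bschubert_asc // scaler0 scale0r.
rewrite ddiffZ /c' /u'; have hZ := SZ_hatP _ (uZ j).
have [h|h] := desc_or_asc (u j) i (uZ j).
  by rewrite h bschubert_desc ?hatP_lt // hatP_sref.
by rewrite ltNge (ltW h) /= bschubert_asc ?hatP_gt // scaler0 scale0r.
Qed.

(** [l] bounds both the lengths that occur and the degree of [g], since the relation itself does not
    compare degrees. Both drop under divided differences, and at l = 0 both sides vanish. *)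
Lemma reversal_bschubert l n (c : 'I_n -> rat) (u : 'I_n -> int -> int) g :
  (forall j, SZ (u j)) -> (forall j, c j != 0 -> (ell (u j) < l)%N) ->
  (forall m, g m != 0 -> (mdeg m < l)%N) ->
  reversal (\sum_j c j *: bschubert (u j)) g ->
  g = \sum_j c j *: bschubert (hatP (u j)).
Proof.
elim: l c u g => [|l IH] c u g uZ ul gl rg.
  have -> : g = 0 by apply: seriesP => m; apply/eqP/negPn/negP => /gl.
  rewrite big1 // => j _; suff -> : c j = 0 by rewrite scale0r.
  by apply/eqP/negPn/negP => /ul.
apply/eqP; rewrite -subr_eq0; apply/eqP; apply: nice_eq0.
- apply: niceB; first exact: reversal_nice rg.
  by apply: nice_sum => j _; apply: bschubert_nice; apply: SZ_hatP.
- move=> k; rewrite ddiffB; apply/eqP; rewrite subr_eq0; apply/eqP.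
  (* d_k acts on the second component, so the first is differentiated by d_(-k). *)
  rewrite -(opprK k); move: (- k) => i.
  have [E1 ->] := ddiff_comb _ i c u uZ.
  apply: IH => [j|j||].
  + by case: ifP => _; [apply: SZ_comp_sref | apply: SZ_id].
  + case: ifP => h; last by rewrite eqxx.
    by move=> /ul; rewrite (ell_desc _ i).
  + exact: ddiff_deg.
  + by rewrite -E1; apply: reversal_ddiff.
- rewrite serB -(reversal_const _ _ rg) !ser_sum; apply/eqP; rewrite subr_eq0.
  by apply/eqP; apply: eq_bigr => j _; rewrite !serZ bschubert_hat_const.
Qed.

Lemma reversal_bsem a : reversal (bsem a) (bchm (hatI a)).
Proof.
have -> : bchm (hatI a) = \prod_(i <- finsupp a) homog (a i) (- i).
  have hatE i : hatI a i = a (- i).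
    rewrite /hatI fsfun_fun; case: ifP => // /negbT h.
    apply/esym/eqP; rewrite -memNfinsupp; apply: contraNN h => h.
    by apply/imfsetP; exists (- i); rewrite ?opprK.
  have -> : bchm (hatI a) =
      \prod_(i <- [fset - j | j in finsupp a]%fset) homog (hatI a i) i.
    congr (\prod_(i <- _) _); congr enum_fset; apply/fsetP => i.
    rewrite mem_finsupp hatE -mem_finsupp; apply/idP/imfsetP => [h|[j /= ja ->]].
      by exists (- i); rewrite ?opprK.
    by rewrite opprK.
  rewrite big_imfset /=; last by move=> i j _ _ /oppr_inj.
  by apply: eq_bigr => i _; rewrite hatE opprK.
rewrite /bsem; elim: (enum_fset (finsupp a)) => [|i r IH].
  rewrite !big_nil -[X in reversal X _](elem0 0) -[X in reversal _ X](homog0 (- 0)).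
  exact: ReversalGen.
by rewrite !big_cons; apply: ReversalMul => //; apply: ReversalGen.
Qed.

Lemma nice_bsem a : nice (bsem a).
Proof.
rewrite /bsem; elim: (enum_fset (finsupp a)) => [|i r IH].
  by rewrite big_nil -(elem0 0); apply: nice_elem.
by rewrite big_cons; apply: nice_mul => //; apply: nice_elem.
Qed.

Lemma nice_deg f : nice f -> exists l, forall m, f m != 0 -> (mdeg m < l)%N.
Proof. by move=> [N [fd _ _]]; exists N.+1 => m /fd. Qed.

Lemma bsem_expansion a : exists n (c : 'I_n -> rat) (u : 'I_n -> int -> int),
  (forall j, SZ (u j)) /\ bsem a = \sum_j c j *: bschubert (u j).
Proof.
have fN := nice_bsem a; have [l fl] := nice_deg _ fN.
have [s0 hs0] := ddiff_right_finite _ _ fN fl.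
(* The list found so far may contain repetitions and maps outside [SZ]. *)
pose s := undup [seq w <- s0 | `[< SZ w >]].
have sZ w : w \in s -> SZ w by rewrite mem_undup mem_filter => /andP[/asboolP].
have E := nice_expansion _ _ s fN fl (undup_uniq _) sZ _.
exists (size s), (fun j => ddiff_right (nth (id : SZtype) s j) (bsem a) mone),
  (fun j => nth (id : SZtype) s j); split.
  by move=> j; apply: sZ; apply: mem_nth.
rewrite {1}E; last first.
  by move=> w wZ wf; rewrite mem_undup mem_filter hs0 // andbT; apply/asboolP.
by rewrite (big_nth (id : SZtype)) big_mkord.
Qed.

Theorem theorem1p2 :
  (forall rho : series -> series,
     (forall f, back_ring f -> back_ring (rho f)) ->
     (forall (a : rat) (f g : series), back_ring f -> back_ring g ->
        rho (a *: f + g) = a *: rho f + rho g) ->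
     (forall w : int -> int, SZ w -> rho (bschubert w) = bschubert (hatP w)) ->
     forall a : cindex, rho (bsem a) = bchm (hatI a)) /\
  (forall (w : int -> int) (kappa : {fsfun cindex -> rat with 0}),
     SZ w ->
     bschubert w = \sum_(a <- finsupp kappa) kappa a *: bsem a ->
     bschubert (hatP w) =
       \sum_(a <- finsupp kappa) kappa a *: bchm (hatI a)).
Proof.
split=> [rho _ rho_lin rhoS a|w kappa wZ wE].
  have [n [c [u [uZ aE]]]] := bsem_expansion a.
  have rg := reversal_bsem a; have [l gl] := nice_deg _ (reversal_nice _ _ rg).
  rewrite aE in rg.
  rewrite (reversal_bschubert (l + \sum_j (ell (u j)).+1)%N n c u _ uZ _ _ rg).
  - rewrite aE; have rho0 : rho 0 = 0.
      have := rho_lin 1 0 0 back_ring0 back_ring0.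
      rewrite !scale1r addr0 => /eqP; rewrite -subr_eq0 opprD addrA subrr sub0r.
      by rewrite oppr_eq0 => /eqP.
    (* [rho] is linear only on [back_ring], so every term and partial sum must be shown to lie
       there. *)
    have BN j : nice (bschubert (u j)) by apply: bschubert_nice.
    elim: (index_enum _) => [|j r IH]; first by rewrite !big_nil.
    rewrite !big_cons rho_lin ?rhoS ?IH //; first exact/nice_back_ring.
    by apply: nice_back_ring; apply: nice_sum.
  - by move=> j _; rewrite (bigD1 j) //=; lia.
  - by move=> m /gl; lia.
(* The given SEM expansion makes this a pair by linearity alone; [reversal_bschubert] for a one-term
   combination then identifies its second component. *)
have rg : reversal (bschubert w) (\sum_(a <- finsupp kappa) kappa a *: bchm (hatI a)).
  rewrite wE; elim: (enum_fset _) => [|a r IH].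
    by rewrite !big_nil; apply: Reversal0.
  by rewrite !big_cons; apply: ReversalLin => //; apply: reversal_bsem.
have [l gl] := nice_deg _ (reversal_nice _ _ rg).
have rg1 : reversal (\sum_(j < 1) 1 *: bschubert w)
    (\sum_(a <- finsupp kappa) kappa a *: bchm (hatI a)).
  by rewrite big_ord1 scale1r.
have := reversal_bschubert (l + ell w).+1 1 _ _ _ (fun=> wZ) _ _ rg1.
rewrite big_ord1 scale1r => ->//.
- by move=> j _; lia.
- by move=> m /gl; lia.
Qed.
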